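(* Let the loss $\ell$ satisfy: $\|\nabla \ell(\mathbf{w},z)\|\le G$ for all $\mathbf{w}\in\mathbb{R}^p$ and all examples $z$; $\ell$ is bounded below by $\ell^\star$; and $\|\nabla\ell(\mathbf{w},z)-\nabla\ell(\mathbf{w}',z)\|\le L\|\mathbf{w}-\mathbf{w}'\|$ for all $\mathbf{w},\mathbf{w}'\in\mathbb{R}^p$ and all $z$. For any integer $T>0$, run NT-SGD on a training set $S$ with $\eta_t=\eta=\frac{1}{\sqrt{T}}$, $\beta=\frac12$, $\sigma^2=\frac{R}{p}$ for any $R\ge0$, and $0\le\varepsilon\le\min\left(1,\frac{\eta L}{2}\right)$. Let $\mathbf{w}_J$ be sampled uniformly from the iterates $\{\mathbf{w}_1,\dots,\mathbf{w}_T\}$ produced by NT-SGD. Then $$\mathbb{E}\|\nabla\mathcal{L}_S(\mathbf{w}_J)\|^2\le O\left(\frac{L(G^2+R^2)}{\sqrt{T}}\right),$$ where the expectation is over the randomness of NT-SGD and the random draw of $\mathbf{w}_J$.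
   Context: $S=\{z_1,\dots,z_n\}$ is a dataset, $\ell(\mathbf{w},z)$ is a (possibly non-convex) differentiable loss, and $\mathcal{L}_S(\mathbf{w})=\frac1n\sum_{i=1}^n\ell(\mathbf{w},z_i)$. NT-SGD (Noisy Truncated SGD) with parameters $\beta\in[0,\frac12]$, $\sigma^2$, $\varepsilon\in[0,1]$, $\eta_t$: from a given initial point $\mathbf{w}_0\in\mathbb{R}^p$, at each step $t=0,1,2,\dots$ draw, independently of the past, a mini-batch $B_t$ uniformly with replacement from $S$, compute $g(\mathbf{w}_t,B_t)=\frac1{|B_t|}\sum_{z_i\in B_t}\nabla\ell(\mathbf{w}_t,z_i)$, and set $\mathbf{w}_{t+1}=\mathbf{w}_t-\eta_t\tilde{\mathbf{g}}_t+\eta_t^{\frac12+\beta}\mathbf{b}_t$ with independent noise $\mathbf{b}_t\sim\mathcal{N}(0,\sigma^2\mathbb{I})$ in $\mathbb{R}^p$. Here $[\tilde{\mathbf{g}}_t]_i=[g(\mathbf{w}_t,B_t)]_i$ if $|[g(\mathbf{w}_t,B_t)]_i|\ge\kappa_{\varepsilon,t}$ and $[\tilde{\mathbf{g}}_t]_i=0$ otherwise. The threshold is determined from $\mathbf{g}=g(\mathbf{w}_t,B_t)$ and $\varepsilon$: sort $[\mathbf{g}]_{(1)}^2\ge\dots\ge[\mathbf{g}]_{(p)}^2$; let $i\in\{1,\dots,p\}$ be the smallest index with $\sum_{j<i}[\mathbf{g}]_{(j)}^2\ge(1-\varepsilon^2)\|\mathbf{g}\|^2$ and put $\kappa_{\varepsilon,t}=|[\mathbf{g}]_{(i)}|$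 (if no such $i$ exists, $\kappa_{\varepsilon,t}=0$). Consequently $\|\tilde{\mathbf{g}}_t\|^2\ge(1-\varepsilon^2)\|g(\mathbf{w}_t,B_t)\|^2$. $O(\cdot)$ refers to the dependence on $T$: the hidden constant factor does not depend on $T$, $R$ or $\varepsilon$; it may depend on problem constants and on the initial optimality gap $\mathcal{L}_S(\mathbf{w}_0)-\ell^\star$, which the paper treats as a constant. *)

(* Defs.v *)
From HB Require Import structures.
From mathcomp Require Import all_boot all_order all_algebra.
From mathcomp Require Import all_classical all_reals all_analysis.

Set Implicit Arguments.
Unset Strict Implicit.
Unset Printing Implicit Defensive.

Import Order.TTheory GRing.Theory Num.Theory.
Import numFieldNormedType.Exports.

Local Open Scope classical_set_scope.
Local Open Scope ring_scope.

(* The library norm [`|v|] on ['rV_p] is the sup norm, hence this one. *)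
Definition enorm {R : realType} {p : nat} (v : 'rV[R]_p) : R :=
  Num.sqrt (\sum_(i < p) v 0 i ^+ 2).

Definition grad {R : realType} {p : nat} (f : 'rV[R]_p -> R) (w : 'rV[R]_p) :
    'rV[R]_p :=
  \row_(i < p) 'D_(delta_mx 0 i) f w.

Definition empirical_loss {R : realType} {p n : nat} {Z : Type}
    (loss : 'rV[R]_p -> Z -> R) (S : 'I_n -> Z) (w : 'rV[R]_p) : R :=
  n%:R^-1 * \sum_(i < n) loss w (S i).

(* A mini-batch of size [m] is the list of the indices drawn; repetitions are
   allowed and count with their multiplicity. *)
Definition batch_grad {R : realType} {p n m : nat} {Z : Type}
    (loss : 'rV[R]_p -> Z -> R) (S : 'I_n -> Z)
    (w : 'rV[R]_p) (B : {ffun 'I_m -> 'I_n}) : 'rV[R]_p :=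
  m%:R^-1 *: \sum_(j < m) grad (loss ^~ (S (B j))) w.

Definition sorted_coords {R : realType} {p : nat} (g : 'rV[R]_p) : seq R :=
  sort (fun x y => y ^+ 2 <= x ^+ 2) [seq g 0 i | i <- enum 'I_p].

(* [find] returns the least 0-based position k < p at which the k largest
   squares already reach the target, i.e. k.+1 is the 1-based index selected;
   it returns p when there is none, and then the threshold is 0. *)
Definition threshold {R : realType} {p : nat} (eps : R) (g : 'rV[R]_p) : R :=
  let s := sorted_coords g in
  let k := find (fun k : nat =>
      (1 - eps ^+ 2) * enorm g ^+ 2 <= \sum_(0 <= j < k) nth 0 s j ^+ 2)
    (iota 0 p) in
  if (k < p)%N then `|nth 0 s k| else 0.

Definition truncate {R : realType} {p : nat} (eps : R) (g : 'rV[R]_p) :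
    'rV[R]_p :=
  \row_(i < p) (if threshold eps g <= `|g 0 i| then g 0 i else 0).

(* One trajectory, as a function of the mini-batches and of the noise. *)
Fixpoint ntsgd {R : realType} {p n : nat} {Z : Type}
    (loss : 'rV[R]_p -> Z -> R) (S : 'I_n -> Z) (w0 : 'rV[R]_p)
    (eta : nat -> R) (beta eps : R) (m : nat -> nat)
    (B : forall t, {ffun 'I_(m t) -> 'I_n}) (b : nat -> 'rV[R]_p) (t : nat) :
    'rV[R]_p :=
  if t is u.+1 then
    let w := ntsgd loss S w0 eta beta eps B b u in
    w - eta u *: truncate eps (batch_grad loss S w (B u))
      + (eta u `^ (2^-1 + beta)) *: b u
  else w0.

(* The library's [normal_prob m s] is not the point mass at [m] when [s = 0]. *)
Definition gaussian {R : realType} (m s : R) (V : set R) : \bar R :=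
  if s == 0 then \d_m V else normal_prob m s V.

(* [F i] is the class of events of the i-th source of randomness. *)
Definition mutually_independent {d : measure_display} {T : measurableType d}
    {R : realType} (P : probability T R) (I : choiceType)
    (F : I -> set (set T)) : Prop :=
  forall (s : seq I) (E : I -> set T), uniq s ->
    (forall i, i \in s -> F i (E i)) ->
    P (\bigcap_(i in [set` s]) E i) = (\prod_(i <- s) P (E i))%E.

(* Sources: [None] is the output index J, [Some (inl t)] the mini-batch of step
   t, and [Some (inr (t, i))] the i-th noise coordinate of step t. *)
Definition source_events {d : measure_display} {T : measurableType d}
    {R : realType} {p n : nat} (m : nat -> nat) (J : T -> nat)
    (B : forall t, T -> {ffun 'I_(m t) -> 'I_n}) (b : nat -> T -> 'rV[R]_p)
    (src : option (nat + nat * 'I_p)) : set (set T) :=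
  match src with
  | None => [set J @^-1` D | D in setT]
  | Some (inl t) => [set B t @^-1` D | D in setT]
  | Some (inr (t, i)) => preimage_set_system setT (fun x => b t x 0 i) measurable
  end.

(* Since the coordinates are jointly independent, [noise_law] amounts to
   b_t ~ N(0, sigma^2 I). *)
Record ntsgd_sampling {d : measure_display} {T : measurableType d}
    {R : realType} (P : probability T R) {p n : nat} (N : nat) (sigma : R)
    (m : nat -> nat) (J : T -> nat)
    (B : forall t, T -> {ffun 'I_(m t) -> 'I_n}) (b : nat -> T -> 'rV[R]_p) :
    Prop := {
  index_measurable : forall k, measurable (J @^-1` [set k]) ;
  index_law : forall k, (1 <= k <= N)%N ->
    P (J @^-1` [set k]) = (N%:R^-1)%:E ;
  batch_measurable : forall t f, measurable (B t @^-1` [set f]) ;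
  batch_law : forall t f,
    P (B t @^-1` [set f]) = (#|{ffun 'I_(m t) -> 'I_n}|%:R^-1)%:E ;
  noise_measurable : forall t i, measurable_fun setT (fun x => b t x 0 i) ;
  noise_law : forall t i (V : set R), measurable V ->
    P ((fun x => b t x 0 i) @^-1` V) = gaussian 0 sigma V ;
  sources_independent : mutually_independent P (source_events J B b) }.

(* Main.v *)
Require Import Defs.
From HB Require Import structures.
From mathcomp Require Import all_boot all_order all_algebra.
From mathcomp Require Import all_classical all_reals all_analysis.
From mathcomp Require Import measurable_realfun ring lra.

Set Implicit Arguments.
Unset Strict Implicit.
Unset Printing Implicit Defensive.

Import Order.TTheory GRing.Theory Num.Theory.
Import numFieldNormedType.Exports.
Local Open Scope ring_scope.

(* The step [w' = w - eta g~ + eta b] obeys the descent inequality of an L-smooth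
   function. Truncation loses at most [eps |g| <= eta L G / 2] of the gradient,
   and the quadratic term is at most [eta^2 L (G^2 + |b|^2)], so no cross term
   between [g~] and [b] has to be computed. In expectation the batch gradient
   becomes the full gradient (uniform batch independent of the past), [<grad, b>]
   vanishes (centred noise independent of the past) and [E|b|^2 <= 6 rho]; the
   telescoped sum bounds the average of [E |grad|^2] by
   [(gap + 12 L rho + 3 L G^2) / sqrt N]. This is of the required form
   [C L (G^2 + rho^2) / sqrt N] if [L, G > 0]. If [G = 0] the gradient vanishes,
   and so it does if [L = 0], as the loss is then affine and bounded below;
   negative [L] or [G] are impossible. *)

(** * Euclidean geometry of row vectors *)

(** Most of the work lies behind [independent of the past]. Independence is given only for finite
    intersections of events, one per source, whereas the expectations involve arbitrary functions of
    all earlier sources. The past of step [t] is therefore turned into a sigma-algebra on the sample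
    space: a pi-system argument extends the product formula to it, and Fubini gives [E[X Y] = E[X]
    E[Y]] for [X] bounded and measurable with respect to the past. Boundedness of the relevant [X]
    comes from [G]. Measurability of the iterates is proved over an arbitrary sigma-algebra and then
    read over that of the past; as truncation depends on a sort, order statistics enter here. No
    conditional expectation is formed: a batch or output index takes countably many values, so it is
    frozen at each value by an indicator. The factor 6 in the noise bound, where the exact value
    would be 1, is the price of comparing the Gaussian density with a wider one instead of computing
    its second moment. *)

Definition dot {R : realType} {p : nat} (u v : 'rV[R]_p) : R :=
  \sum_(i < p) u 0 i * v 0 i.

Section euclidean.
Context {R : realType} {p : nat}.
Implicit Types (u v w : 'rV[R]_p) (a : R).

Lemma dotC u v : dot u v = dot v u.
Proof. by apply: eq_bigr => i _; rewrite mulrC. Qed.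

Lemma dotDr u v w : dot u (v + w) = dot u v + dot u w.
Proof. by rewrite -big_split; apply: eq_bigr => i _; rewrite mxE mulrDr. Qed.

Lemma dotZr a u v : dot u (a *: v) = a * dot u v.
Proof. by rewrite mulr_sumr; apply: eq_bigr => i _; rewrite mxE mulrCA. Qed.

Lemma dotNr u v : dot u (- v) = - dot u v.
Proof. by rewrite -scaleN1r dotZr mulN1r. Qed.

Lemma dotBr u v w : dot u (v - w) = dot u v - dot u w.
Proof. by rewrite dotDr dotNr. Qed.

Lemma dotBl u v w : dot (u - v) w = dot u w - dot v w.
Proof. by rewrite dotC dotBr !(dotC w). Qed.

Lemma enorm_ge0 u : 0 <= enorm u.
Proof. exact: sqrtr_ge0. Qed.

Lemma enorm_sqr u : enorm u ^+ 2 = \sum_(i < p) u 0 i ^+ 2.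
Proof. by rewrite sqr_sqrtr// sumr_ge0// => i _; rewrite sqr_ge0. Qed.

Lemma enorm_dot u : enorm u ^+ 2 = dot u u.
Proof. by rewrite enorm_sqr; apply: eq_bigr => i _; rewrite expr2. Qed.

Lemma sqr_le_enorm u i : u 0 i ^+ 2 <= enorm u ^+ 2.
Proof.
by rewrite enorm_sqr (bigD1 i)//= lerDl sumr_ge0// => j _; rewrite sqr_ge0.
Qed.

Lemma norm_le_enorm u i : `|u 0 i| <= enorm u.
Proof.
by rewrite -ler_sqr ?nnegrE ?enorm_ge0// real_normK ?num_real// sqr_le_enorm.
Qed.

Lemma enorm_le u a : 0 <= a -> enorm u ^+ 2 <= a ^+ 2 -> enorm u <= a.
Proof. by move=> a0; rewrite ler_sqr ?nnegrE ?enorm_ge0. Qed.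

Lemma enorm_eq0 u : enorm u = 0 -> u = 0.
Proof.
move=> u0; apply/rowP => i; rewrite mxE; apply/eqP.
by rewrite -normr_le0 (le_trans (norm_le_enorm u i))// u0.
Qed.

Lemma enorm0 : enorm (0 : 'rV[R]_p) = 0.
Proof. by rewrite /enorm big1 ?sqrtr0// => i _; rewrite mxE expr0n. Qed.

Lemma enormZ a u : enorm (a *: u) = `|a| * enorm u.
Proof.
rewrite -sqrtr_sqr -sqrtrM ?sqr_ge0// mulr_sumr; congr Num.sqrt.
by apply: eq_bigr => i _; rewrite mxE exprMn.
Qed.

Lemma dot0r u : dot u 0 = 0.
Proof. by rewrite /dot big1// => i _; rewrite mxE mulr0. Qed.

Lemma cauchy_schwarz u v : dot u v <= enorm u * enorm v.
Proof.
have [u0|u0] := eqVneq (enorm u) 0.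
  by rewrite (enorm_eq0 u0) dotC dot0r mulr_ge0 ?enorm_ge0.
have [v0|v0] := eqVneq (enorm v) 0.
  by rewrite (enorm_eq0 v0) dot0r mulr_ge0 ?enorm_ge0.
have uv : 0 < enorm u * enorm v by rewrite mulr_gt0// lt_def ?u0 ?v0 enorm_ge0.
rewrite -(ler_pM2l uv).
(* The square expands to [2 |u| |v| (|u| |v| - dot u v)], twice the difference of the two sides of
   the goal. *)
have : 0 <= enorm (enorm v *: u - enorm u *: v) ^+ 2 by rewrite sqr_ge0.
rewrite enorm_dot dotBr !dotZr !dotBl !(dotC _ u) !(dotC _ v) !dotZr -!enorm_dot.
by rewrite (dotC v u); nra.
Qed.

Lemma enormB_sqr u v : enorm (u - v) ^+ 2 <= 2 * (enorm u ^+ 2 + enorm v ^+ 2).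
Proof.
rewrite !enorm_sqr -big_split/= mulr_sumr ler_sum//= => i _; rewrite !mxE.
have := sqr_ge0 (u 0 i + v 0 i); nra.
Qed.

Lemma enormD u v : enorm (u + v) <= enorm u + enorm v.
Proof.
apply: enorm_le; first by rewrite addr_ge0 ?enorm_ge0.
rewrite enorm_dot dotDr !(dotC (u + v)) !dotDr -!enorm_dot (dotC v u).
by have := cauchy_schwarz u v; nra.
Qed.

Lemma enorm_sum (I : Type) (r : seq I) (F : I -> 'rV[R]_p) :
  enorm (\sum_(i <- r) F i) <= \sum_(i <- r) enorm (F i).
Proof.
elim/big_ind2 : _ => //; first by rewrite enorm0.
by move=> x a y b xa yb; rewrite (le_trans (enormD _ _))// lerD.
Qed.

Lemma enorm_avg (k : nat) (F : 'I_k -> 'rV[R]_p) a : (0 < k)%N ->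
  (forall i, enorm (F i) <= a) -> enorm (k%:R^-1 *: \sum_i F i) <= a.
Proof.
move=> k0 Fa; rewrite enormZ ger0_norm ?invr_ge0// ler_pdivrMl ?ltr0n//.
apply: le_trans (enorm_sum _ _) _; apply: le_trans (ler_sum _ (fun i _ => Fa i)) _.
by rewrite sumr_const card_ord mulr_natl.
Qed.

End euclidean.

(** * Gradients and the descent inequality *)

Section gradient.
Local Open Scope classical_set_scope.
Context {R : realType} {p : nat}.
Implicit Types (f : 'rV[R]_p -> R) (w h : 'rV[R]_p).

Lemma derive_grad f w h : differentiable f w -> 'D_h f w = dot (grad f w) h.
Proof.
move=> df; rewrite deriveE// [in LHS](row_sum_delta h) linear_sum.
by apply: eq_bigr => i _; rewrite linearZ mxE deriveE// mulrC.
Qed.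

Lemma is_derive_line f w h (s : R) : differentiable f (w + s *: h) ->
  is_derive s 1 (fun r : R => f (w + r *: h)) (dot (grad f (w + s *: h)) h).
Proof.
move=> df.
have E : (fun e : R => e^-1 *: (f (w + (e *: 1 + s) *: h) - f (w + s *: h))) =
         (fun e : R => e^-1 *: (f (e *: h + (w + s *: h)) - f (w + s *: h))).
  apply/funext => e; congr (_ *: (f _ - _)).
  by rewrite [e *: 1]mulr1 scalerDl addrCA addrA.
have df' := @diff_derivable _ _ _ f _ h df.
split; first by rewrite /derivable /= /shift /= E.
by rewrite -derive_grad// /derive /= /shift /= E.
Qed.

Lemma descent f (L : R) w h : (forall x, differentiable f x) ->
  (forall x y, enorm (grad f x - grad f y) <= L * enorm (x - y)) ->
  f (w + h) <= f w + dot (grad f w) h + L / 2 * enorm h ^+ 2.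
Proof.
move=> df Lf.
(* The claim is [phi 1 <= phi 0]. By the mean value theorem the difference is [dphi c] for some [c]
   in []0, 1[], and the Lipschitz bound between [w + c *: h] and [w] makes it nonpositive. *)
pose phi (s : R) := f (w + s *: h) - s * dot (grad f w) h
                    - s ^+ 2 * (L / 2 * enorm h ^+ 2).
pose dphi (s : R) := dot (grad f (w + s *: h)) h - dot (grad f w) h
                    - s * (L * enorm h ^+ 2).
have Dphi (s : R) : is_derive s (1 : R) phi (dphi s).
  have D1 := is_derive_line (df (w + s *: h)).
  rewrite (_ : phi = (fun r => f (w + r *: h))
      - id * cst (dot (grad f w) h) - id ^+ 2 * cst (L / 2 * enorm h ^+ 2)) //.
  apply: is_derive_eq; rewrite /dphi /= !scaler0 /GRing.scale/=.
  by rewrite !add0r; field.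
have cphi : {within `[0, 1], continuous phi}.
  apply: continuous_subspaceT => s.
  by apply: differentiable_continuous; apply/derivable1_diffP; case: (Dphi s).
have [c /itvP c01] := MVT ltr01 (fun s _ => Dphi s) cphi.
have c0 : 0 < c by rewrite c01.
rewrite /phi /dphi !(scale0r, scale1r, addr0, mul0r, mul1r, expr1n, expr0n) /=.
rewrite !subr0 ?mulr1 -dotBl => phi01.
have : dot (grad f (w + c *: h) - grad f w) h <= c * (L * enorm h ^+ 2).
  apply: le_trans (cauchy_schwarz _ _) _.
  have := Lf (w + c *: h) w; rewrite addrAC subrr add0r enormZ gtr0_norm//.
  by have := enorm_ge0 h; nra.
by lra.
Qed.

End gradient.

(** * Empirical loss and unbiased mini-batch gradients *)

Section empirical.
Context {R : realType} {p n : nat} {Z : Type}.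
Variables (loss : 'rV[R]_p -> Z -> R) (S : 'I_n -> Z).

(* The descent inequality now holds for steps of any length. *)
Lemma grad_flat (f : 'rV[R]_p -> R) (c : R) (w : 'rV[R]_p) :
  (forall x, differentiable f x) ->
  (forall x y, enorm (grad f x - grad f y) <= 0 * enorm (x - y)) ->
  (forall x, c <= f x) -> grad f w = 0.
Proof.
move=> df Lf cf; apply: enorm_eq0; apply/eqP; rewrite -sqrf_eq0.
apply: contraT => g0; set g := grad f w in g0 *.
(* The step length is chosen so that the descent bound equals [c - 1], below the lower bound [c]. *)
have := descent w (- ((f w - c + 1) / enorm g ^+ 2) *: g) df Lf.
have := cf (w + (- ((f w - c + 1) / enorm g ^+ 2) *: g)).
rewrite dotZr -enorm_dot mulNr divfK// mul0r mul0r addr0; lra.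
Qed.

Hypothesis dloss : forall z w, differentiable (loss ^~ z) w.

Lemma empirical_lossE :
  empirical_loss loss S = n%:R^-1 \*: (\sum_(i < n) (loss ^~ (S i))).
Proof. by apply/funext => w; rewrite /empirical_loss /= fct_sumE. Qed.

Lemma differentiable_empirical w : differentiable (empirical_loss loss S) w.
Proof.
rewrite empirical_lossE; apply: differentiableZ; exact: differentiable_sum.
Qed.

Lemma grad_empirical w :
  grad (empirical_loss loss S) w =
  n%:R^-1 *: \sum_(i < n) grad (loss ^~ (S i)) w.
Proof.
apply/rowP => i; rewrite !mxE summxE empirical_lossE deriveZ; last first.
  by apply: derivable_sum => j; apply: diff_derivable.
rewrite derive_sum; last by move=> j; apply: diff_derivable.
by congr (_ * _); apply: eq_bigr => j _; rewrite mxE.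
Qed.

Lemma empirical_lipschitz (L : R) : (0 < n)%N ->
  (forall x y z, enorm (grad (loss ^~ z) x - grad (loss ^~ z) y)
                 <= L * enorm (x - y)) ->
  forall x y, enorm (grad (empirical_loss loss S) x
                     - grad (empirical_loss loss S) y) <= L * enorm (x - y).
Proof.
by move=> n0 Lf x y; rewrite !grad_empirical -scalerBr -sumrB; exact: enorm_avg.
Qed.

Lemma enorm_grad_empirical (G : R) w : (0 < n)%N ->
  (forall x z, enorm (grad (loss ^~ z) x) <= G) ->
  enorm (grad (empirical_loss loss S) w) <= G.
Proof. by move=> n0 GG; rewrite grad_empirical; exact: enorm_avg. Qed.

Lemma enorm_batch_grad (m : nat) (B : {ffun 'I_m -> 'I_n}) (G : R) w :
  (0 < m)%N -> (forall x z, enorm (grad (loss ^~ z) x) <= G) ->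
  enorm (batch_grad loss S w B) <= G.
Proof. by move=> m0 GG; exact: enorm_avg. Qed.

Lemma empirical_ge (c : R) w : (0 < n)%N ->
  (forall x z, c <= loss x z) -> c <= empirical_loss loss S w.
Proof.
move=> n0 cl; rewrite /empirical_loss ler_pdivlMl ?ltr0n//.
rewrite mulr_natl -[in leLHS](card_ord n) -sumr_const.
by apply: ler_sum => i _; exact: cl.
Qed.

End empirical.


(** Each value [i] is taken at [j] by exactly [n ^ (m - 1)] functions; the factor [n] turns this
    count into the full cardinal without a division. Writing [h (f j)] as a product with factors 1
    at the other coordinates lets the sum over functions distribute. *)
Lemma sum_ffun_coord {R : comNzRingType} (m n : nat) (h : 'I_n -> R) (j : 'I_m) :
  n%:R * \sum_(f : {ffun 'I_m -> 'I_n}) h (f j) =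
  #|{ffun 'I_m -> 'I_n}|%:R * \sum_i h i.
Proof.
have -> : \sum_(f : {ffun 'I_m -> 'I_n}) h (f j) =
    \sum_(f : {ffun 'I_m -> 'I_n}) \prod_k (if k == j then h (f k) else 1).
  apply: eq_bigr => f _; rewrite (bigD1 j)//= eqxx big1 ?mulr1//.
  by move=> k /negbTE ->.
rewrite -(bigA_distr_bigA (fun k i => if k == j then h i else 1)) (bigD1 j)//=.
rewrite eqxx mulrCA mulrC; congr (_ * _).
rewrite card_ffun !card_ord (eq_bigr (fun=> n%:R)); last first.
  by move=> k /negbTE ->; rewrite sumr_const card_ord.
rewrite prodr_const cardC1 card_ord -exprS prednK ?natrX//.
by case: m j => // -[].
Qed.

(** Unbiasedness of the mini-batch gradient, in counting form: dividing by the number of batches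
    gives the mean under the uniform law. *)
Lemma sum_batch_grad {R : realType} {p n m : nat} {Z : Type}
    (loss : 'rV[R]_p -> Z -> R) (S : 'I_n -> Z) (w : 'rV[R]_p) :
  (forall z w, differentiable (loss ^~ z) w) -> (0 < n)%N -> (0 < m)%N ->
  \sum_(B : {ffun 'I_m -> 'I_n}) batch_grad loss S w B =
  #|{ffun 'I_m -> 'I_n}|%:R *: grad (empirical_loss loss S) w.
Proof.
move=> dl n0 m0; apply/rowP => i; rewrite grad_empirical// summxE !mxE summxE.
have n0' : n%:R != 0 :> R by rewrite pnatr_eq0 -lt0n.
have m0' : m%:R != 0 :> R by rewrite pnatr_eq0 -lt0n.
under eq_bigr do rewrite mxE summxE.
rewrite -mulr_sumr exchange_big /=.
rewrite (eq_bigr (fun=> #|{ffun 'I_m -> 'I_n}|%:R * (n%:R^-1 *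
  \sum_i0 grad (loss^~ (S i0)) w 0 i))); last first.
  move=> j _; apply: (mulfI n0').
  by rewrite (sum_ffun_coord (fun k => grad (loss^~ (S k)) w 0 i)) mulrCA mulVKf.
by rewrite sumr_const card_ord -(mulr_natl (_ * _)) mulKf.
Qed.

(** * Truncation *)

Section truncation.
Context {R : realType} {p : nat}.
Implicit Types (g : 'rV[R]_p) (eps : R).

Lemma size_sorted_coords g : size (sorted_coords g) = p.
Proof. by rewrite size_sort size_map size_enum_ord. Qed.

Lemma perm_sorted_coords g :
  perm_eq (sorted_coords g) [seq g 0 i | i <- enum 'I_p].
Proof. by rewrite perm_sort. Qed.

Lemma big_sorted_coords g (F : R -> R) :
  \sum_(i < p) F (g 0 i) = \sum_(0 <= j < p) F (nth 0 (sorted_coords g) j).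
Proof.
transitivity (\sum_(x <- sorted_coords g) F x).
  by rewrite (perm_big _ (perm_sorted_coords g)) big_map -big_enum.
by rewrite (big_nth 0) size_sorted_coords.
Qed.

Lemma sorted_coords_sqr g j k : (j <= k < p)%N ->
  nth 0 (sorted_coords g) k ^+ 2 <= nth 0 (sorted_coords g) j ^+ 2.
Proof.
move=> /andP[jk kp].
pose geS (x y : R) := y ^+ 2 <= x ^+ 2.
have tr : transitive geS by move=> x y z yx xz; exact: le_trans xz yx.
have ss : sorted geS (sorted_coords g).
  by apply: sort_sorted => x y; exact: le_total.
apply: (sorted_leq_nth tr _ 0 ss) => //; rewrite ?inE ?size_sorted_coords//.
- by move=> x; exact: lexx.
- exact: leq_ltn_trans kp.
Qed.

Lemma enorm_truncate eps g :
  enorm (truncate eps g) ^+ 2 =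
  \sum_(i < p | threshold eps g <= `|g 0 i|) g 0 i ^+ 2.
Proof.
rewrite enorm_sqr [RHS]big_mkcond; apply: eq_bigr => i _; rewrite mxE.
by case: ifP; rewrite ?expr0n.
Qed.

(** When [find] succeeds at [k], the [k] largest squares already reach the target, and all of them
    pass the threshold because they dominate the square at position [k]. Further coordinates that
    pass, such as ties, only increase the sum. When [find] fails, the threshold is 0 and nothing is
    cut. *)
Lemma enorm_truncate_ge eps g :
  (1 - eps ^+ 2) * enorm g ^+ 2 <= enorm (truncate eps g) ^+ 2.
Proof.
rewrite enorm_truncate /threshold; case: ifP => [kp|_]; last first.
  rewrite (eq_bigl xpredT) => [|i]; last by rewrite normr_ge0.
  by rewrite -enorm_sqr ler_piMl ?sqr_ge0// lerBlDr lerDl sqr_ge0.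
set P := fun k : nat => _ in kp *; set k := find _ _ in kp *.
have /(nth_find 0) : has P (iota 0 p) by rewrite has_find size_iota.
rewrite -/k nth_iota// add0n {1}/P => /le_trans; apply.
set s := sorted_coords g.
rewrite [leRHS]big_mkcond [leRHS](big_sorted_coords g
  (fun x => if `|nth 0 s k| <= `|x| then x ^+ 2 else 0)).
rewrite (@big_cat_nat _ _ _ k 0 p)//=; last exact: ltnW.
rewrite -[leLHS]addr0 lerD//; last first.
  by apply: sumr_ge0 => j _; case: ifP => // _; rewrite sqr_ge0.
rewrite !big_nat ler_sum// => j /andP[_ jk].
rewrite ifT// -ler_sqr ?nnegrE// !real_normK ?num_real//.
by rewrite sorted_coords_sqr// (ltnW jk).
Qed.

(** Pythagoras: kept and discarded parts have disjoint supports. *)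
Lemma enormB_truncate eps g :
  enorm (g - truncate eps g) ^+ 2 = enorm g ^+ 2 - enorm (truncate eps g) ^+ 2.
Proof.
rewrite !enorm_sqr -sumrB; apply: eq_bigr => i _; rewrite !mxE.
by case: ifP => _; rewrite ?subrr ?subr0 expr0n ?subr0.
Qed.

Lemma enorm_truncate_le eps g : enorm (truncate eps g) <= enorm g.
Proof.
apply: enorm_le; first exact: enorm_ge0.
by rewrite -subr_ge0 -enormB_truncate sqr_ge0.
Qed.

Lemma enormB_truncate_le eps g : 0 <= eps ->
  enorm (g - truncate eps g) <= eps * enorm g.
Proof.
move=> e0; apply: enorm_le; first by rewrite mulr_ge0 ?enorm_ge0.
by rewrite enormB_truncate; have := enorm_truncate_ge eps g; nra.
Qed.

End truncation.

(** * Measurability of truncation, gradients and iterates *)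

Section measurability.
Local Open Scope classical_set_scope.
Context {d} {T : measurableType d} {R : realType}.

(** A random choice among countably many measurable functions: the preimage splits along the fibres
    of [B]. This serves for the batch, the output index and the grid points below. *)
Lemma measurable_select (I : countType) d' (U : measurableType d')
    (B : T -> I) (h : I -> T -> U) :
  (forall i, measurable (B @^-1` [set i])) ->
  (forall i, measurable_fun setT (h i)) ->
  measurable_fun setT (fun x => h (B x) x).
Proof.
move=> mB mh _ V mV; rewrite setTI.
have -> : (fun x => h (B x) x) @^-1` V =
    \bigcup_(i in [set: I]) (B @^-1` [set i] `&` h i @^-1` V).
  apply/seteqP; split=> [x Vx|x [i _ [/= <-]]]//.
  by exists (B x).
apply: countable_bigcupT_measurable => //= i.
by apply: measurableI => //; rewrite -[X in measurable X]setTI; exact: mh.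
Qed.

Lemma measurable_preimage_countable (I : countType)
    (B : T -> I) (D : set I) :
  (forall i, measurable (B @^-1` [set i])) -> measurable (B @^-1` D).
Proof.
move=> mB; have mD := @measurable_select I _ bool B (fun i _ => `[< D i >]) mB
  (fun=> measurable_cst _).
rewrite (_ : B @^-1` D = setT `&` (fun x => `[< D (B x) >]) @^-1` [set true]).
  exact: mD.
by rewrite setTI; apply/seteqP; split => x /= /asboolP.
Qed.

Lemma measurable_sorted_coords_sqr {p} (X : T -> 'rV[R]_p) j :
  (forall i, measurable_fun setT (fun x => X x 0 i)) ->
  measurable_fun setT (fun x => nth 0 (sorted_coords (X x)) j ^+ 2).
Proof.
move=> mX; have [jp|pj] := ltnP j p; last first.
  rewrite (_ : (fun _ => _) = cst 0)//; apply/funext => x /=.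
  by rewrite nth_default ?size_sorted_coords// expr0n.
(* the j-th largest square (from 0) is >= a iff more than j squares are *)
apply: (measurability (@RGenCInfty.G R)); first exact: RGenCInfty.measurableE.
move=> _ [_ [a ->] <-]; rewrite setTI.
rewrite (_ : _ @^-1` _ = (fun x => j%:R < \sum_(i < p)
    (if a <= X x 0 i ^+ 2 then 1 else 0 : R)) @^-1` [set true]).
  rewrite -[X in measurable X]setTI; apply: measurable_fun_ltr => //.
  apply: measurable_sum => i; apply: measurable_fun_ifT => //.
  by apply: measurable_fun_ler => //; exact: measurable_funX.
apply/seteqP; split => x /=; rewrite in_itv/= andbT;
  rewrite (big_sorted_coords (X x) (fun y => if a <= y ^+ 2 then 1 else 0)).
- move=> ax; rewrite (@big_cat_nat _ _ _ j.+1 0 p)//= ltr_wpDr//.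
    by apply: sumr_ge0 => k _; case: ifP.
  rewrite big_nat (eq_bigr (fun=> 1)) -?big_nat ?sumr_const_nat ?subn0 ?ltr_nat//.
  move=> k /andP[_ kj]; rewrite (le_trans ax)// sorted_coords_sqr//.
  by rewrite -ltnS kj.
- apply: contraTT; rewrite -ltNge -leNgt => ax.
  rewrite (@big_cat_nat _ _ _ j 0 p)//=; last exact: ltnW.
  rewrite [X in _ + X]big_nat [X in _ + X]big1 => [|k /andP[jk kp]].
    rewrite addr0 -[in leRHS](subn0 j) -sumr_const_nat.
    by apply: ler_sum => k _; case: ifP.
  by rewrite leNgt (le_lt_trans _ ax)// sorted_coords_sqr// jk.
Qed.

(** Unrolls the search into nested conditionals, so that measurability of the threshold follows by
    induction on the list. *)
Lemma find_iotaE (f : pred nat) (F : nat -> R) a n :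
  (if (find f (iota a n) < n)%N then F (a + find f (iota a n))%N else 0) =
  foldr (fun k r => if f k then F k else r) 0 (iota a n).
Proof.
elim: n a => [|n IH] a //=; case: (f a) => /=; first by rewrite addn0.
by rewrite -IH ltnS addnS addSn.
Qed.

Lemma measurable_sqrt : measurable_fun setT (@Num.sqrt R).
Proof. by apply: continuous_measurable_fun; exact: sqrt_continuous. Qed.

Lemma measurable_enorm {p} (X : T -> 'rV[R]_p) :
  (forall i, measurable_fun setT (fun x => X x 0 i)) ->
  measurable_fun setT (fun x => enorm (X x)).
Proof.
move=> mX; apply: (measurableT_comp measurable_sqrt).
by apply: measurable_sum => i; exact: measurable_funX.
Qed.

Lemma measurable_threshold {p} eps (X : T -> 'rV[R]_p) :
  (forall i, measurable_fun setT (fun x => X x 0 i)) ->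
  measurable_fun setT (fun x => threshold eps (X x)).
Proof.
move=> mX; pose c x (k : nat) := (1 - eps ^+ 2) * enorm (X x) ^+ 2 <=
  \sum_(0 <= j < k) nth 0 (sorted_coords (X x)) j ^+ 2.
(* The modulus is replaced by the root of the square: the sorted squares are order statistics, while
   the sign of a sorted entry depends on how [sort] breaks ties. *)
rewrite (_ : (fun _ => _) = (fun x => foldr (fun k r =>
  if c x k then Num.sqrt (nth 0 (sorted_coords (X x)) k ^+ 2) else r) 0
  (iota 0 p))); last first.
  apply/funext => x; rewrite -(find_iotaE (c x) (fun k =>
    Num.sqrt (nth 0 (sorted_coords (X x)) k ^+ 2))).
  by rewrite add0n sqrtr_sqr.
elim: (iota 0 p) => [|k s IH] //=.
apply: measurable_fun_ifT => //.
- apply: measurable_fun_ler.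
    apply: measurable_funM => //; apply: measurable_funX; exact: measurable_enorm.
  by apply: measurable_sum => j; exact: measurable_sorted_coords_sqr.
- apply: (measurableT_comp measurable_sqrt); exact: measurable_sorted_coords_sqr.
Qed.

Lemma measurable_truncate {p} eps (X : T -> 'rV[R]_p) :
  (forall i, measurable_fun setT (fun x => X x 0 i)) ->
  forall i, measurable_fun setT (fun x => truncate eps (X x) 0 i).
Proof.
move=> mX i; under eq_fun do rewrite mxE.
apply: measurable_fun_ifT => //; apply: measurable_fun_ler.
  exact: measurable_threshold.
exact: measurableT_comp.
Qed.

(* Discretize [X] on the grid of step 1/(k+1): the composite with [f] then
   takes countably many values. *)
Lemma measurable_continuous_rV {p} (f : 'rV[R]_p -> R) (X : T -> 'rV[R]_p) :
  continuous f -> (forall i, measurable_fun setT (fun x => X x 0 i)) ->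
  measurable_fun setT (f \o X).
Proof.
move=> cf mX.
pose N k x : 'rV[int]_p := \row_i Num.floor (k.+1%:R * X x 0 i).
pose h k x := f (\row_i ((N k x 0 i)%:~R / k.+1%:R)).
apply: (measurable_fun_cvg (h := h)) => [k|x _].
- apply: (measurable_select (B := N k)
    (h := fun v _ => f (\row_i ((v 0 i)%:~R / k.+1%:R)))) => // v.
  have -> : N k @^-1` [set v] = \big[setI/setT]_(i <- enum 'I_p)
      [set x | Num.floor (k.+1%:R * X x 0 i) = v 0 i].
    apply/seteqP; split => x /=.
      by move=> <-; elim/big_ind : _ => //= i _; rewrite mxE.
    move=> H; apply/rowP => i; rewrite mxE.
    move: H; rewrite (bigD1_seq i) ?mem_enum ?enum_uniq//= => -[].
    by [].
  apply: bigsetI_measurable => // i _.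
  rewrite (_ : [set _ | _] = (fun x => ((v 0 i)%:~R <= k.+1%:R * X x 0 i) &&
      (k.+1%:R * X x 0 i < (v 0 i + 1)%:~R)) @^-1` [set true]).
    rewrite -[X in measurable X]setTI; apply: measurable_and => //.
      by apply: measurable_fun_ler => //; exact: measurable_funM.
    by apply: measurable_fun_ltr => //; exact: measurable_funM.
  apply/seteqP; split=> x /=.
    by move=> <-; rewrite floor_le_tmp lt_succ_floor.
  by move=> /andP[? ?]; apply/eqP; rewrite floor_eq; apply/andP.
- suff Nx : (fun k => \row_i ((N k x 0 i)%:~R / k.+1%:R)) @ \oo --> X x.
    exact: (cvg_comp _ _ Nx (cf (X x))).
  apply/cvg_ballP => e e0.
  near=> k; split=> // i j; rewrite ord1 !mxE /ball /= distrC.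
  have k0 : 0 < k.+1%:R :> R by rewrite ltr0n.
  set y := Num.floor _; have -> : y%:~R / k.+1%:R - X x 0 j =
    (y%:~R - k.+1%:R * X x 0 j) / k.+1%:R by field; rewrite lt0r_neq0.
  rewrite normrM [X in _ * X]gtr0_norm ?invr_gt0// distrC.
  apply: (@le_lt_trans _ _ k.+1%:R^-1); last by near: k; exact: (near_infty_natSinv_lt (PosNum e0)).
  rewrite ler_piMl ?invr_ge0 ?ler0n// ger0_norm ?subr_ge0 /y ?floor_le_tmp//.
  by have := lt_succ_floor (k.+1%:R * X x 0 j); rewrite intrD mulr1z; lra.
Unshelve. all: by end_near. Qed.

End measurability.

Section measurability.
Local Open Scope classical_set_scope.
Context {d} {T : measurableType d} {R : realType} {p : nat}.

(** A partial derivative is the pointwise limit of the difference quotients with steps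
    [1 / (k + 1)], each a continuous function of [X]. *)
Lemma measurable_grad (f : 'rV[R]_p -> R) (X : T -> 'rV[R]_p) i :
  (forall w, differentiable f w) ->
  (forall i, measurable_fun setT (fun x => X x 0 i)) ->
  measurable_fun setT (fun x => grad f (X x) 0 i).
Proof.
move=> df mX.
have cf : continuous f by move=> w; exact: differentiable_continuous.
pose e : 'rV[R]_p := delta_mx 0 i.
pose h (k : nat) x : R := (k.+1%:R^-1)^-1 *: (f (k.+1%:R^-1 *: e + X x) - f (X x)).
apply: (measurable_fun_cvg (h := h)) => [k|x _].
  apply: measurable_funM => //; apply: measurable_funB.
    apply: measurable_continuous_rV => // j.
    by under eq_fun do rewrite mxE; exact: measurable_funD.
  exact: measurable_continuous_rV.
rewrite mxE.
have /cvgr_dnbhsP : (fun r : R => r^-1 *: (f (r *: e + X x) - f (X x))) @ 0^'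
  --> 'D_e f (X x) by exact: (@diff_derivable _ _ _ f _ e (df (X x))).
by apply; split => //; exact: cvg_harmonic.
Qed.

Section trajectory.
Variables (n : nat) (Z : Type) (loss : 'rV[R]_p -> Z -> R) (S : 'I_n -> Z).
Hypothesis dloss : forall z w, differentiable (loss ^~ z) w.

Lemma measurable_batch_grad (m : nat) (B : {ffun 'I_m -> 'I_n})
    (X : T -> 'rV[R]_p) :
  (forall i, measurable_fun setT (fun x => X x 0 i)) ->
  forall i, measurable_fun setT (fun x => batch_grad loss S (X x) B 0 i).
Proof.
move=> mX i; under eq_fun do rewrite mxE summxE.
apply: measurable_funM => //; apply: measurable_sum => j.
by apply: measurable_grad.
Qed.

(** Only sources before [t] are assumed measurable, so that the lemma also applies when [T] carries
    just the sigma-algebra of the past. *)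
Lemma measurable_ntsgd (w0 : 'rV[R]_p) (eta : nat -> R) (beta eps : R)
    (m : nat -> nat) (B : forall t, T -> {ffun 'I_(m t) -> 'I_n})
    (b : nat -> T -> 'rV[R]_p) (t : nat) :
  (forall u f, (u < t)%N -> measurable (B u @^-1` [set f])) ->
  (forall u i, (u < t)%N -> measurable_fun setT (fun x => b u x 0 i)) ->
  forall i, measurable_fun setT (fun x =>
    ntsgd loss S w0 eta beta eps (fun u => B u x) (fun u => b u x) t 0 i).
Proof.
elim: t => [|t IH] mB mb i /=; first exact: measurable_cst.
have {}IH := IH (fun u f ut => mB u f (leqW ut)) (fun u i ut => mb u i (leqW ut)).
pose w x := ntsgd loss S w0 eta beta eps (fun u => B u x) (fun u => b u x) t.
pose h (f : {ffun 'I_(m t) -> 'I_n}) x : R :=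
  truncate eps (batch_grad loss S (w x) f) 0 i.
rewrite (_ : (fun _ => _) = fun x =>
    w x 0 i - eta t * h (B t x) x + eta t `^ (2^-1 + beta) * b t x 0 i); last first.
  by apply/funext => x; rewrite /h /w !mxE.
apply: measurable_funD; last by apply: measurable_funM => //; exact: mb.
apply: measurable_funB => //; apply: measurable_funM => //.
apply: (measurable_select (h := h)) => f; first exact: mB.
apply: measurable_truncate; exact: measurable_batch_grad.
Qed.

End trajectory.
End measurability.

(** * Independence *)

Section independence.
Local Open Scope classical_set_scope.
Context {d} {T : measurableType d} {R : realType} (P : probability T R).

(* The joint law of [f] and [Y] is the product of their laws, so Fubini applies. *)
Lemma product_expectation d' (T' : measurableType d') (f : {mfun T >-> T'})
    (Y : {mfun T >-> R}) (X : T' -> R) (c : R) :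
  (forall A V, measurable A -> measurable V ->
    P (f @^-1` A `&` Y @^-1` V) = (P (f @^-1` A) * P (Y @^-1` V))%E) ->
  measurable_fun setT X -> (forall x, `|X x| <= c) ->
  P.-integrable setT (EFin \o Y) ->
  \int[P]_x (X (f x) * Y x) = (\int[P]_x X (f x)) * \int[P]_x Y x.
Proof.
move=> indep mX Xc iY.
have mfY : measurable_fun setT (fun x => (f x, Y x)).
  by apply: measurable_fun_pair.
pose fY : {mfun T >-> (T' * R)%type} :=
  MeasurableFun.Pack (MeasurableFun.Class (isMeasurableFun.Build _ _ _ _ _ mfY)).
pose h (z : T' * R) := (X z.1 * z.2)%:E.
have mh : measurable_fun setT h.
  apply/measurable_EFinP; apply: measurable_funM => //.
  exact: measurableT_comp.
have iX : P.-integrable setT (EFin \o (X \o f)).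
  apply: (@le_integrable _ _ _ P _ measurableT _ (cst c%:E)).
  - by apply/measurable_EFinP; exact: measurableT_comp.
  - by move=> x _ /=; rewrite lee_fin (le_trans (Xc _))// ler_norm.
  - exact: finite_measure_integrable_cst.
have iXY : P.-integrable setT (h \o fY).
  apply: (@le_integrable _ _ _ P _ measurableT _ (fun x => c%:E * (EFin \o Y) x)%E).
  - exact: measurableT_comp.
  - move=> x _ /=; rewrite lee_fin normrM [leRHS]normrM.
    by rewrite ler_wpM2r// (le_trans (Xc _))// ler_norm.
  - exact: integrableZl.
have prodE (A : set (T' * R)) : measurable A ->
    (distribution P f \x distribution P Y)%E A = distribution P fY A.
  by move=> mA; apply: product_measure_unique => // U V mU mV; exact: indep.
have ih : (distribution P f \x distribution P Y)%E.-integrable setT h.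
  apply/integrableP; split => //.
  rewrite (@eq_measure_integral _ _ _ _ (distribution P fY)); last first.
    by move=> A mA _; exact: prodE.
  rewrite ge0_integral_distribution//; last exact: measurableT_comp.
  by case/integrableP : iXY.
have -> : \int[P]_x (X (f x) * Y x) = fine (\int[distribution P fY]_z h z).
  by rewrite integral_distribution.
rewrite (@eq_measure_integral _ _ _ _
  (distribution P f \x distribution P Y)%E); last first.
  by move=> A mA _; exact/esym/prodE.
rewrite -integral12_prod_meas1//.
have -> : (\int[P]_x X (f x)) = \int[distribution P f]_y X y.
  by rewrite /Rintegral integral_distribution//; exact/measurable_EFinP.
have iYd : (distribution P Y).-integrable setT (EFin \o id).
  by apply: integrable_pushforward => //; exact/measurable_EFinP.
have iXd : (distribution P f).-integrable setT (EFin \o X).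
  by apply: integrable_pushforward => //; exact/measurable_EFinP.
have EY : (\int[distribution P Y]_y y%:E)%E = (\int[P]_x Y x)%:E.
  rewrite integral_distribution//.
  by rewrite /Rintegral fineK//; exact: integrable_fin_num.
rewrite -RintegralZr//; congr fine; apply: eq_integral => x _.
rewrite /fubini_F /h /=; under eq_integral do rewrite EFinM.
by rewrite integralZl// EY EFinM.
Qed.

Section mutual_independence.
Variables (I : choiceType) (F : I -> set (set T)).
Hypothesis F_measurable : forall i, F i `<=` measurable.
Hypothesis F_setT : forall i, F i setT.
Hypothesis F_setI : forall i, setI_closed (F i).
Hypothesis F_indep : mutually_independent P F.

(** The pi-system that generates the sigma-algebra of the sources in [s]; [mutually_independent]
    evaluates [P] exactly on such intersections. *)
Definition joint_events (s : seq I) : set (set T) :=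
  [set X | exists2 E : I -> set T, (forall i, i \in s -> F i (E i)) &
    X = \bigcap_(i in [set` s]) E i].

Lemma joint_events_measurable s : joint_events s `<=` measurable.
Proof.
move=> _ [E FE ->]; apply: fin_bigcap_measurable => // i si.
exact: F_measurable (FE i si).
Qed.

Lemma joint_events_setI s : setI_closed (joint_events s).
Proof.
move=> _ _ [E FE ->] [E' FE' ->]; exists (fun i => E i `&` E' i).
  by move=> i si; apply: F_setI; [exact: FE|exact: FE'].
by rewrite bigcapI.
Qed.

Lemma joint_events_setT s : joint_events s setT.
Proof.
exists (fun=> setT) => [i _|]; first exact: F_setT.
by apply/seteqP; split.
Qed.

Lemma joint_events_source s i D : i \in s -> F i D -> joint_events s D.
Proof.
move=> si FD; exists (fun j => if j == i then D else setT).
  by move=> j _; case: eqP => // ->.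
apply/seteqP; split => [x Dx j _|x /(_ i si)]; last by rewrite eqxx.
by case: eqP.
Qed.

Lemma sigma_joint_events_measurable s : <<s joint_events s >> `<=` measurable.
Proof.
apply: smallest_sub; first exact: sigma_algebra_measurable.
exact: joint_events_measurable.
Qed.

(** For fixed [D], the finite measures [A |-> P (A & D)] and [A |-> P A * P D] agree on the
    pi-system [joint_events s], hence on the sigma-algebra it generates. *)
Lemma joint_events_indep s j D A : uniq s -> j \notin s -> F j D ->
  <<s joint_events s >> A -> P (A `&` D) = (P A * P D)%E.
Proof.
move=> us js FD sA; have mD := F_measurable FD.
pose m2 := mscale (NngNum (fine_ge0 (measure_ge0 P D))) P.
have PD : (fine (P D))%:E = P D by rewrite fineK// fin_num_measure.
have m2E X : m2 X = (P X * P D)%E by rewrite muleC -[in RHS]PD.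
rewrite -m2E; apply: (g_sigma_algebra_measure_unique (joint_events s) _
  (fun=> setT) _ _ (mrestr P mD) m2) => //.
- exact: joint_events_measurable.
- by move=> _; exact: joint_events_setT.
- by rewrite bigcup_const.
- exact: joint_events_setI.
- move=> _ [E FE ->].
  (* One family indexed by [j :: s], as [mutually_independent] requires; since [j] is not in [s],
     the override leaves [E] intact on [s]. *)
  pose E' i := if i == j then D else E i.
  have E'E i : i \in s -> E' i = E i.
    by rewrite /E'; case: eqP => // ->; rewrite (negbTE js).
  have FE' i : i \in j :: s -> F i (E' i).
    rewrite inE => /orP[/eqP ->|si]; first by rewrite /E' eqxx.
    by rewrite E'E//; exact: FE.
  have := F_indep (_ : uniq (j :: s)) FE'; rewrite /= js us big_cons => /(_ isT).
  have -> : \bigcap_(i in [set` j :: s]) E' i = \bigcap_(i in [set` s]) E i `&` D.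
    apply/seteqP; split => x.
      move=> H; split; last by have := H j (mem_head _ _); rewrite /E' eqxx.
      by move=> i si; rewrite -E'E//; apply: H; rewrite /= inE si orbT.
    move=> [H Dx] i; rewrite /= inE => /orP[/eqP ->|si]; first by rewrite /E' eqxx.
    by rewrite E'E//; exact: H.
  have E'j : E' j = D by rewrite /E' eqxx.
  rewrite E'j => H; apply: etrans (esym (m2E _)).
  rewrite [RHS]muleC /mrestr H; congr (_ * _)%E.
  rewrite (F_indep us FE) big_seq [RHS]big_seq.
  by apply: eq_bigr => i si; rewrite E'E.
- by move=> _; exact: fin_num_fun_lty.
Qed.

Lemma expectation_indep s j (X Y : T -> R) (c : R) : uniq s -> j \notin s ->
  measurable_fun setT (X : g_sigma_algebraType (joint_events s) -> R) ->
  (forall x, `|X x| <= c) ->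
  (forall V, measurable V -> F j (Y @^-1` V)) ->
  P.-integrable setT (EFin \o Y) ->
  \int[P]_x (X x * Y x) = (\int[P]_x X x) * \int[P]_x Y x.
Proof.
move=> us js mX Xc FY iY.
pose T' := g_sigma_algebraType (joint_events s).
(* The identity, seen as a random element of [T] with the coarser sigma-algebra, carries the
   information of [s]; then [X] is a function of it. *)
have mid : measurable_fun setT (id : T -> T').
  by move=> _ A mA; rewrite setTI; exact: sigma_joint_events_measurable mA.
have mY : measurable_fun setT Y.
  by move=> _ V mV; rewrite setTI; exact: F_measurable (FY V mV).
pose f : {mfun T >-> T'} :=
  MeasurableFun.Pack (MeasurableFun.Class (isMeasurableFun.Build _ _ _ _ _ mid)).
pose Y' : {mfun T >-> R} :=
  MeasurableFun.Pack (MeasurableFun.Class (isMeasurableFun.Build _ _ _ _ _ mY)).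
apply: (@product_expectation _ T' f Y' X c) => // A V mA mV.
exact: (joint_events_indep us js (FY V mV) mA).
Qed.

End mutual_independence.
End independence.

(** * Gaussian moments *)

Section density.
Local Open Scope classical_set_scope.
Local Open Scope ereal_scope.
Context {d} {T : measurableType d} {R : realType}.
Variables (mu nu : {measure set T -> \bar R}) (g : T -> R).
Hypothesis g0 : forall x, (0 <= g x)%R.
Hypothesis mg : measurable_fun setT g.
Hypothesis nuE : forall V, measurable V -> nu V = \int[mu]_(x in V) (g x)%:E.

Import HBNNSimple.

Let integral_density_indic (r : R) (E : set T) : measurable E ->
  (0 <= r)%R ->
  \int[nu]_x (r * \1_E x)%:E = \int[mu]_x (r * \1_E x * g x)%:E.
Proof.
move=> mE r0.
under eq_integral do rewrite EFinM.
rewrite ge0_integralZl//; last exact/measurable_EFinP/measurable_indic.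
rewrite integral_indic// setIT nuE// integral_mkcond -ge0_integralZl//; first last.
  by move=> x _; rewrite patchE; case: ifP => //; rewrite lee_fin.
  apply/(measurable_restrictT _ _).1 => //.
  by apply/measurable_funTS/measurable_EFinP.
apply: eq_integral => x _; rewrite patchE indicE.
by case: ifPn => xE; rewrite ?mulr1 ?mulr0 ?mul0r ?mule0 ?EFinM.
Qed.

Let integral_density_nnsfun (h : {nnsfun T >-> R}) :
  \int[nu]_x (h x)%:E = \int[mu]_x (h x * g x)%:E.
Proof.
under [LHS]eq_integral do rewrite fimfunE -fsumEFin//.
rewrite [LHS]ge0_integral_fsum//; last 2 first.
  - by move=> r; exact/measurable_EFinP/measurableT_comp.
  - by move=> n x _; rewrite EFinM nnfun_muleindic_ge0.
under [RHS]eq_integral.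
  move=> x xD; rewrite EFinM fimfunE -fsumEFin// ge0_mule_fsuml; last first.
    by move=> r; rewrite EFinM nnfun_muleindic_ge0.
  over.
rewrite [RHS]ge0_integral_fsum//; last 2 first.
  - move=> r; apply: emeasurable_funM; last exact/measurable_EFinP.
    by apply/measurable_EFinP/measurableT_comp.
  - move=> n x _; rewrite mule_ge0//; last by rewrite lee_fin.
    by rewrite EFinM nnfun_muleindic_ge0.
apply: eq_fsbigr => r _.
have [r0|r0] := leP 0%R r; first by rewrite integral_density_indic.
by rewrite preimage_nnfun0// !integral0_eq// => x _; rewrite indic0 mulr0 ?mul0e.
Qed.

(** Indicators, then simple functions, then monotone convergence along [nnsfun_approx]. It transfers
    integrals against [normal_prob] to Lebesgue integrals. *)
Lemma ge0_integral_density (f : T -> \bar R) :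
  measurable_fun setT f -> (forall x, 0 <= f x) ->
  \int[nu]_x f x = \int[mu]_x (f x * (g x)%:E).
Proof.
move=> mf f0.
pose f_ := nnsfun_approx measurableT mf.
have f_f x : (f_ n x)%:E @[n --> \oo] --> f x by exact: cvg_nnsfun_approx.
transitivity (lim (\int[nu]_x (f_ n x)%:E @[n --> \oo])).
  rewrite -monotone_convergence//=.
  - by apply: eq_integral => x _; exact/esym/cvg_lim.
  - by move=> n; exact/measurable_EFinP/measurable_funTS.
  - by move=> n ? _; rewrite lee_fin.
  - by move=> ? _ ? ? mn; rewrite lee_fin; exact/lefP/nd_nnsfun_approx.
transitivity (lim (\int[mu]_x (f_ n x * g x)%:E @[n --> \oo])).
  by apply: congr_lim; apply/funext => n; exact: integral_density_nnsfun.
rewrite -monotone_convergence//=.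
- apply: eq_integral => x _; apply/cvg_lim => //.
  under eq_fun do rewrite EFinM.
  exact: cvgeZr (f_f x).
- by move=> n; apply/measurable_EFinP/measurable_funM => //; exact: measurable_funTS.
- by move=> n x _; rewrite lee_fin mulr_ge0.
- move=> x _ m n mn; rewrite lee_fin ler_wpM2r//.
  exact/lefP/nd_nnsfun_approx.
Qed.

End density.

Section gaussian_moments.
Local Open Scope classical_set_scope.
Context {R : realType}.
Implicit Type s : R.

(** Symmetry of the law, from an even density and the reflection invariance of Lebesgue measure. It
    yields the zero mean without computing an integral. *)
Lemma gaussianN s (V : set R) : measurable V ->
  gaussian 0 s (-%R @^-1` V) = gaussian 0 s V.
Proof.
move=> mV; rewrite /gaussian; have [_|s0] := eqVneq s 0.
  rewrite !diracE (_ : (0 \in -%R @^-1` V) = (0 \in V))//.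
  by apply/idP/idP; rewrite !inE/= oppr0.
rewrite /normal_prob.
transitivity (\int[lebesgue_measure]_(x in (-%R : _ -> measurableTypeR R) @^-1` V)
    (normal_pdf 0 s (- x)%R)%:E)%E.
  by apply: eq_integral => x _; rewrite !normal_pdfE// /normal_fun !subr0 sqrrN.
rewrite -(@ge0_integral_pushforward _ _ _ (measurableTypeR R) _ _ _ lebesgue_measure _
  (fun x : measurableTypeR R => (normal_pdf 0 s x)%:E))//=.
- by apply: eq_measure_integral => //= A mA _; exact: lebesgue_measureN.
- by apply/measurable_EFinP/measurable_funTS; exact: measurable_normal_pdf.
- by move=> x _; rewrite lee_fin normal_pdf_ge0.
Qed.

(* [u <= exp u] trades the square for a wider Gaussian density. *)
Lemma sqr_normal_pdf_le s x : 0 < s ->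
  x ^+ 2 * normal_pdf 0 s x <= 6 * s ^+ 2 * normal_pdf 0 (2 * s) x.
Proof.
move=> s0; have s2 : 0 < 2 * s by rewrite mulr_gt0.
rewrite !normal_pdfE ?gt_eqF//.
have -> : normal_peak s = 2 * normal_peak (2 * s).
  rewrite /normal_peak.
  have -> : (2 * s) ^+ 2 * pi *+ 2 = 2 ^+ 2 * (s ^+ 2 * pi *+ 2) by ring.
  by rewrite sqrtrM ?sqr_ge0// sqrtr_sqr ger0_norm// invfM mulVKf.
set k := normal_peak (2 * s).
have k0 : 0 < k by rewrite normal_peak_gt0 ?gt_eqF.
(* [expR u] is the ratio of the two exponentials: [x^2 / (2 s^2) - x^2 / (8 s^2) = 3 x^2 / (8
   s^2)]. *)
pose u := 3 * x ^+ 2 / (8 * s ^+ 2).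
have ux : 3 * x ^+ 2 = 8 * s ^+ 2 * u by rewrite /u; field; rewrite gt_eqF.
have -> : normal_fun 0 (2 * s) x = expR u * normal_fun 0 s x.
  by rewrite /normal_fun -expRD; congr expR; rewrite /u; field; rewrite gt_eqF.
have u_exp : u <= expR u by have := expR_ge1Dx u; lra.
have kf0 : 0 <= k * normal_fun 0 s x by rewrite mulr_ge0 ?normal_fun_ge0 ?ltW.
have := ler_wpM2r kf0 (ler_wpM2l (sqr_ge0 s) u_exp).
have : 0 <= s ^+ 2 * expR u * (k * normal_fun 0 s x).
  by apply: mulr_ge0 => //; rewrite mulr_ge0 ?sqr_ge0 ?expR_ge0.
(* The peak ratio 2 times [8 / 3] from solving for [x ^+ 2] gives [16 / 3], rounded up to 6. *)
have -> : x ^+ 2 * (2 * k * normal_fun 0 s x) =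
  16 / 3 * (s ^+ 2 * u * (k * normal_fun 0 s x)).
  have -> : x ^+ 2 = 8 / 3 * (s ^+ 2 * u) by lra.
  by field.
have -> : 6 * s ^+ 2 * (k * (expR u * normal_fun 0 s x)) =
  6 * (s ^+ 2 * expR u * (k * normal_fun 0 s x)) by ring.
lra.
Qed.

Lemma normal_second_moment s : 0 < s ->
  (\int[normal_prob 0 s]_x (x ^+ 2)%:E <= (6 * s ^+ 2)%:E)%E.
Proof.
move=> s0.
rewrite (@ge0_integral_density _ _ _ lebesgue_measure _ (normal_pdf 0 s))//;
  last 4 first.
- exact: normal_pdf_ge0.
- exact: measurable_normal_pdf.
- by apply/measurable_EFinP; exact: measurable_funX.
- by move=> x; rewrite lee_fin sqr_ge0.
apply: (@le_trans _ _ (\int[lebesgue_measure]_x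
  ((6 * s ^+ 2)%:E * (normal_pdf 0 (2 * s) x)%:E))%E).
  apply: ge0_le_integral => //=.
  - by move=> x _; rewrite lee_fin mulr_ge0 ?sqr_ge0 ?normal_pdf_ge0.
  - apply/measurable_EFinP; apply: measurable_funM; first exact: measurable_funX.
    exact: measurable_normal_pdf.
  - apply/measurable_EFinP; apply: measurable_funM => //.
    exact: measurable_normal_pdf.
  - by move=> x _; rewrite lee_fin sqr_normal_pdf_le.
rewrite ge0_integralZl//.
- by rewrite integral_normal_pdf mule1.
- by apply/measurable_EFinP; exact: measurable_normal_pdf.
- by move=> x _; rewrite lee_fin normal_pdf_ge0.
- by rewrite lee_fin mulr_ge0 ?sqr_ge0.
Qed.

Context {d} {T : measurableType d} (P : probability T R).
Variables (Y : T -> R) (s : R).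
Hypothesis s0 : 0 <= s.
Hypothesis mY : measurable_fun setT Y.
Hypothesis lawY : forall V, measurable V -> P (Y @^-1` V) = gaussian 0 s V.

Let Y' : {mfun T >-> measurableTypeR R} :=
  MeasurableFun.Pack (MeasurableFun.Class (isMeasurableFun.Build _ _ T (measurableTypeR R) Y mY)).

Lemma gaussian_sqr_le : (\int[P]_x (Y x ^+ 2)%:E <= (6 * s ^+ 2)%:E)%E.
Proof.
have msqr : measurable_fun setT (fun y : R => (y ^+ 2)%:E).
  by apply/measurable_EFinP; exact: measurable_funX.
rewrite -(@ge0_integral_distribution _ _ _ _ _ P Y' (fun y => (y ^+ 2)%:E))//;
  last by move=> y; rewrite lee_fin sqr_ge0.
have [sz|sn0] := eqVneq s 0.
  rewrite (@eq_measure_integral _ _ _ _ (\d_(0 : measurableTypeR R) : {measure set (measurableTypeR R) -> \bar R})).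
    by rewrite integral_dirac// diracT mul1e sz !expr0n mulr0.
  by move=> A mA _ /=; apply: etrans (lawY mA) _; rewrite /gaussian sz eqxx.
rewrite (@eq_measure_integral _ _ _ _ (normal_prob 0 s)).
  by apply: normal_second_moment; rewrite lt_def sn0.
by move=> A mA _ /=; apply: etrans (lawY mA) _; rewrite /gaussian (negbTE sn0).
Qed.

Lemma gaussian_sqr_integrable : P.-integrable setT (fun x => (Y x ^+ 2)%:E).
Proof.
apply/integrableP; split; first by apply/measurable_EFinP; exact: measurable_funX.
under eq_integral do rewrite gee0_abs ?lee_fin ?sqr_ge0//.
by apply: le_lt_trans gaussian_sqr_le _; rewrite ltry.
Qed.

Lemma gaussian_Rintegral_sqr_le : \int[P]_x (Y x ^+ 2) <= 6 * s ^+ 2.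
Proof.
rewrite -lee_fin /Rintegral fineK ?gaussian_sqr_le//.
exact: integrable_fin_num gaussian_sqr_integrable.
Qed.

Lemma gaussian_integrable : P.-integrable setT (EFin \o Y).
Proof.
apply: (@le_integrable _ _ _ P _ measurableT _ (fun x => (1 + Y x ^+ 2)%:E)).
- exact/measurable_EFinP.
- move=> x _ /=; rewrite lee_fin [leRHS]ger0_norm ?addr_ge0 ?sqr_ge0//.
  by rewrite -[Y x ^+ 2]real_normK ?num_real//; nra.
- under eq_fun do rewrite EFinD.
  apply: integrableD => //; last exact: gaussian_sqr_integrable.
  exact: finite_measure_integrable_cst.
Qed.

(** [Y] and [- Y] have the same law, so the mean equals its own opposite. *)
Lemma gaussian_mean0 : \int[P]_x Y x = 0.
Proof.
have mN : measurable_fun setT (fun x => - Y x) by exact: measurableT_comp.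
pose N : {mfun T >-> measurableTypeR R} :=
  MeasurableFun.Pack (MeasurableFun.Class (isMeasurableFun.Build _ _ T (measurableTypeR R) (fun x => - Y x) mN)).
have : \int[P]_x Y x = \int[P]_x (- Y x).
  congr fine.
  transitivity (\int[distribution P Y']_y y%:E)%E.
    by rewrite integral_distribution//; exact: gaussian_integrable.
  transitivity (\int[distribution P N]_y y%:E)%E.
    apply: eq_measure_integral => A mA _.
    apply: etrans (lawY mA) _; rewrite -gaussianN// -lawY//.
    by rewrite -[X in measurable X]setTI; exact: oppr_measurable.
  rewrite integral_distribution//.
  by apply: eq_integrable (integrableN gaussian_integrable).
under [in RHS]eq_Rintegral do rewrite -mulN1r.
by rewrite RintegralZl//; [lra|exact: gaussian_integrable].
Qed.

End gaussian_moments.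

(** * Integration of real random variables *)

Section expectation.
Local Open Scope classical_set_scope.
Context {d} {T : measurableType d} {R : realType} (P : probability T R).
Implicit Types X Y : T -> R.

Definition Rintegrable X := P.-integrable setT (EFin \o X).

Lemma Rintegrable_measurable X : Rintegrable X -> measurable_fun setT X.
Proof. by case/integrableP => /measurable_EFinP. Qed.

Lemma Rintegrable_le X Y : measurable_fun setT X -> Rintegrable Y ->
  (forall x, `|X x| <= `|Y x|) -> Rintegrable X.
Proof.
move=> mX iY XY; apply: (@le_integrable _ _ _ P _ measurableT _ (EFin \o Y)) => //.
  exact/measurable_EFinP.
by move=> x _; rewrite /= lee_fin.
Qed.

Lemma Rintegrable_cst (c : R) : Rintegrable (cst c).
Proof. exact: finite_measure_integrable_cst. Qed.

Lemma Rintegrable_bounded X c : measurable_fun setT X ->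
  (forall x, `|X x| <= c) -> Rintegrable X.
Proof.
move=> mX Xc; apply: (Rintegrable_le mX (Rintegrable_cst c)) => x.
exact: le_trans (Xc x) (ler_norm _).
Qed.

Lemma RintegrableD X Y : Rintegrable X -> Rintegrable Y ->
  Rintegrable (fun x => X x + Y x).
Proof. by move=> iX iY; exact: (integrableD measurableT iX iY). Qed.

Lemma RintegrableZ X (c : R) : Rintegrable X -> Rintegrable (fun x => c * X x).
Proof. by move=> iX; exact: (integrableZl measurableT c iX). Qed.

Lemma RintegrableMb X Y c : measurable_fun setT X -> (forall x, `|X x| <= c) ->
  Rintegrable Y -> Rintegrable (fun x => X x * Y x).
Proof.
move=> mX Xc iY; apply: (Rintegrable_le _ (RintegrableZ c iY)).
  by apply: measurable_funM => //; exact: Rintegrable_measurable.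
by move=> x; rewrite !normrM ler_wpM2r// (le_trans (Xc x))// ler_norm.
Qed.

Lemma Rintegrable_sum (I : Type) (r : seq I) (X : I -> T -> R) :
  (forall i, Rintegrable (X i)) -> Rintegrable (fun x => \sum_(i <- r) X i x).
Proof.
move=> iX; elim: r => [|i r IH].
  by under eq_fun do rewrite big_nil; exact: Rintegrable_cst.
by under eq_fun do rewrite big_cons; exact: RintegrableD.
Qed.

Lemma Rintegral_sum (I : Type) (r : seq I) (X : I -> T -> R) :
  (forall i, Rintegrable (X i)) ->
  \int[P]_x (\sum_(i <- r) X i x) = \sum_(i <- r) \int[P]_x X i x.
Proof.
move=> iX; elim: r => [|i r IH].
  rewrite big_nil; under eq_Rintegral do rewrite big_nil.
  by rewrite Rintegral_cst// mul0r.
under eq_Rintegral do rewrite big_cons.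
by rewrite big_cons RintegralD ?IH//; [exact: iX|exact: Rintegrable_sum].
Qed.

Lemma Rintegral_cst1 (c : R) : \int[P]_x c = c.
Proof. by rewrite Rintegral_cst// [X in fine X]probability_setT mulr1. Qed.

Lemma Rintegral_pred1 (I : eqType) (B : T -> I) i :
  measurable (B @^-1` [set i]) ->
  \int[P]_x (B x == i)%:R = fine (P (B @^-1` [set i])).
Proof.
move=> mB; rewrite /Rintegral; congr fine.
rewrite -[in RHS](setIT (B @^-1` _)) -integral_indic//.
apply: eq_integral => x _; rewrite indicE.
by have -> : (x \in B @^-1` [set i]) = (B x == i) by apply/idP/eqP; rewrite inE.
Qed.

End expectation.

(** * Expectations along the run of NT-SGD *)

Section sampling.
Local Open Scope classical_set_scope.
Context {d} {T : measurableType d} {R : realType} {P : probability T R}.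
Context {p n N : nat} {sigma : R} {m : nat -> nat} {J : T -> nat}.
Context {B : forall t, T -> {ffun 'I_(m t) -> 'I_n}} {b : nat -> T -> 'rV[R]_p}.
Hypothesis samp : ntsgd_sampling P N sigma J B b.

Local Notation F := (source_events J B b).

Lemma source_events_measurable s : F s `<=` measurable.
Proof.
case: s => [[t|[t i]]|] /= _ [D DD <-].
- by apply: measurable_preimage_countable => f; exact: (batch_measurable samp).
- exact: (noise_measurable samp t i measurableT).
- by apply: measurable_preimage_countable => k; exact: (index_measurable samp).
Qed.

Lemma source_events_setT s : F s setT.
Proof. by case: s => [[t|[t i]]|] /=; exists setT; rewrite ?setIT. Qed.

Lemma source_events_setI s : setI_closed (F s).
Proof.
case: s => [[t|[t i]]|] /= _ _ [D mD <-] [E mE <-]; exists (D `&` E) => //.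
  exact: measurableI.
by rewrite setIACA setIid.
Qed.

(** The sources that determine iterate [t]; [undup] makes the uniqueness demanded by
    [mutually_independent] immediate. *)
Definition past (t : nat) : seq (option (nat + nat * 'I_p)) :=
  undup ([seq Some (inl u) | u <- iota 0 t] ++
         [seq Some (inr (u, i)) | u <- iota 0 t, i <- enum 'I_p]).

Lemma past_uniq t : uniq (past t).
Proof. exact: undup_uniq. Qed.

Lemma past_batch t u : (Some (inl u) \in past t) = (u < t)%N.
Proof.
rewrite mem_undup mem_cat; apply/orP/idP => [[/mapP[v + [->]]|]|ut].
- by rewrite mem_iota.
- by case/allpairsP => -[] ? ? [].
- by left; apply/mapP; exists u; rewrite ?mem_iota.
Qed.

Lemma past_noise t u i : (Some (inr (u, i)) \in past t) = (u < t)%N.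
Proof.
rewrite mem_undup mem_cat; apply/orP/idP => [[/mapP[]//|]|ut].
- by case/allpairsP => -[v j] [+ _ [-> _]]; rewrite mem_iota.
- right; apply/allpairsP; exists (u, i).
  by rewrite mem_iota mem_enum.
Qed.

Lemma past_index t : None \notin past t.
Proof.
rewrite mem_undup mem_cat negb_or; apply/andP; split.
  by apply/negP => /mapP[].
by apply/negP => /allpairsP[[? ?] []].
Qed.

(** The iterates are adapted to the filtration of the pasts. *)
Lemma measurable_ntsgd_past {Z : Type} (loss : 'rV[R]_p -> Z -> R)
    (S : 'I_n -> Z) (w0 : 'rV[R]_p) (eta : nat -> R) (beta eps : R) t i :
  (forall z w, differentiable (loss ^~ z) w) ->
  measurable_fun setT
   ((fun x => ntsgd loss S w0 eta beta eps (fun u => B u x) (fun u => b u x) t 0 i)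
   : g_sigma_algebraType (joint_events F (past t)) -> R).
Proof.
move=> dl.
apply: (@measurable_ntsgd _ (g_sigma_algebraType (joint_events F (past t)))) => //.
- move=> u f ut; apply: sub_sigma_algebra.
  apply: (@joint_events_source _ _ _ _ source_events_setT _ (Some (inl u))).
    by rewrite past_batch.
  by exists [set f].
- move=> u j ut _ V mV; apply: sub_sigma_algebra.
  apply: (@joint_events_source _ _ _ _ source_events_setT _ (Some (inr (u, j)))).
    by rewrite past_noise.
  by exists V.
Qed.

Lemma expectation_past t s (X Y : T -> R) (c : R) : s \notin past t ->
  measurable_fun setT (X : g_sigma_algebraType (joint_events F (past t)) -> R) ->
  (forall x, `|X x| <= c) ->
  (forall V, measurable V -> F s (Y @^-1` V)) ->
  Rintegrable P Y ->
  \int[P]_x (X x * Y x) = (\int[P]_x X x) * \int[P]_x Y x.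
Proof.
move=> st mX Xc FY iY.
exact: (expectation_indep source_events_measurable source_events_setT
  source_events_setI (sources_independent samp) (past_uniq t) st mX Xc FY iY).
Qed.

Lemma expectation_noise t i (X : T -> R) (c : R) : 0 <= sigma ->
  measurable_fun setT (X : g_sigma_algebraType (joint_events F (past t)) -> R) ->
  (forall x, `|X x| <= c) ->
  \int[P]_x (X x * b t x 0 i) = 0.
Proof.
move=> s0 mX Xc; have mb := noise_measurable samp t i.
rewrite (expectation_past (s := Some (inr (t, i))) _ mX Xc).
- by rewrite (gaussian_mean0 s0 mb (noise_law samp t i)) mulr0.
- by rewrite past_noise ltnn.
- by move=> V mV; exists V => //; rewrite setTI.
- exact: (gaussian_integrable s0 mb (noise_law samp t i)).
Qed.

(** Replaces conditioning on the past: [X (B t x) x] is the sum over [f] of [X f x] times the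
    indicator of [B t x = f], and each indicator is independent of the past. *)
Lemma expectation_batch t (X : {ffun 'I_(m t) -> 'I_n} -> T -> R) (c : R) :
  (forall f, measurable_fun setT
    (X f : g_sigma_algebraType (joint_events F (past t)) -> R)) ->
  (forall f x, `|X f x| <= c) ->
  \int[P]_x X (B t x) x =
  #|{ffun 'I_(m t) -> 'I_n}|%:R^-1 * \sum_f \int[P]_x X f x.
Proof.
move=> mX Xc.
have FY f V : F (Some (inl t)) ((fun x => (B t x == f)%:R : R) @^-1` V).
  by exists [set g | V (g == f)%:R].
have mY f : measurable_fun setT (fun x => (B t x == f)%:R : R).
  by move=> _ V _; rewrite setTI; exact: source_events_measurable (FY f V).
have iY f : Rintegrable P (fun x => (B t x == f)%:R).
  by apply: (@Rintegrable_bounded _ _ _ P _ 1) => // x; case: eqP; rewrite ?normr1 ?normr0.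
have mX' f : measurable_fun (setT : set T) (X f).
  move=> _ V mV; have := mX f measurableT V mV.
  apply: sigma_joint_events_measurable; exact: source_events_measurable.
transitivity (\int[P]_x \sum_f (X f x * (B t x == f)%:R)).
  apply: eq_Rintegral => x _; rewrite (bigD1 (B t x))//= eqxx mulr1 big1 ?addr0//.
  by move=> f /negbTE; rewrite eq_sym => ->; rewrite mulr0.
rewrite Rintegral_sum => [|f]; last exact: RintegrableMb (mX' f) (Xc f) (iY f).
rewrite mulr_sumr; apply: eq_bigr => f _.
rewrite (expectation_past (s := Some (inl t)) _ (mX f) (Xc f))//; last first.
  by rewrite past_batch ltnn.
rewrite (Rintegral_pred1 P (batch_measurable samp f)) (batch_law samp) /=.
by rewrite mulrC.
Qed.

Lemma expectation_index (X : nat -> T -> R) (c : R) : (0 < N)%N ->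
  (forall k, measurable_fun setT
    (X k : g_sigma_algebraType (joint_events F (past k)) -> R)) ->
  (forall k x, 0 <= X k x <= c) ->
  measurable_fun setT (fun x => X (J x) x) ->
  \int[P]_x X (J x) x <= N%:R^-1 * \sum_(1 <= k < N.+1) \int[P]_x X k x.
Proof.
move=> N0 mX Xc mXJ.
have nXc k x : `|X k x| <= c by have /andP[X0 ?] := Xc k x; rewrite ger0_norm.
have FY k V : F None ((fun x => (J x == k)%:R : R) @^-1` V).
  by exists [set j | V (j == k)%:R].
have mY k : measurable_fun setT (fun x => (J x == k)%:R : R).
  by move=> _ V _; rewrite setTI; exact: source_events_measurable (FY k V).
have iY k : Rintegrable P (fun x => (J x == k)%:R).
  by apply: (@Rintegrable_bounded _ _ _ P _ 1) => // x; case: eqP; rewrite ?normr1 ?normr0.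
have mX' k : measurable_fun (setT : set T) (X k).
  move=> _ V mV; have := mX k measurableT V mV.
  apply: sigma_joint_events_measurable; exact: source_events_measurable.
have iXY k : Rintegrable P (fun x => X k x * (J x == k)%:R).
  exact: RintegrableMb (mX' k) (nXc k) (iY k).
have EY k : (1 <= k < N.+1)%N -> \int[P]_x (J x == k)%:R = N%:R^-1.
  move=> kN; rewrite (Rintegral_pred1 P (index_measurable samp k)).
  by rewrite (index_law samp).
have iD k : Rintegrable P (fun x => X k x * (J x == k)%:R + - c * (J x == k)%:R).
  by apply: RintegrableD => //; exact: RintegrableZ.
(* This majorant is exact when [J x] lies in [1..N] and equals the bound [c] elsewhere, so the event
   that [J] leaves the range needs no separate treatment. In expectation the two contributions of
   [c] cancel, as [N] masses [1 / N] add up to 1. *)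
apply: (@le_trans _ _ (\int[P]_x (c + \sum_(1 <= k < N.+1)
    (X k x * (J x == k)%:R + - c * (J x == k)%:R)))).
  apply: le_Rintegral => //.
  - exact: (@Rintegrable_bounded _ _ _ P _ c mXJ).
  - by apply: RintegrableD; [exact: Rintegrable_cst|exact: Rintegrable_sum].
  - move=> x _; have [JN|JN] := boolP (J x \in index_iota 1 N.+1).
      rewrite (bigD1_seq (J x)) ?iota_uniq//= big1 => [|k /negbTE kJ].
        by rewrite eqxx !mulr1 addr0; lra.
      by rewrite eq_sym kJ !mulr0 addr0.
    rewrite big_seq big1 ?addr0 => [|k kN]; first by have /andP[] := Xc (J x) x.
    case: eqP => [Jk|_]; last by rewrite !mulr0 addr0.
    by rewrite Jk kN in JN.
rewrite RintegralD//; [|exact: Rintegrable_cst|exact: Rintegrable_sum].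
rewrite Rintegral_cst1 Rintegral_sum//.
rewrite big_nat (eq_bigr (fun k => N%:R^-1 * \int[P]_x X k x - c / N%:R)).
  rewrite -big_nat sumrB -mulr_sumr sumr_const_nat subSS subn0 -(mulr_natr (c / _)).
  by rewrite divfK ?pnatr_eq0 -?lt0n//; lra.
move=> k kN; rewrite RintegralD//; [|exact: iXY|exact: RintegrableZ].
rewrite (expectation_past (s := None) (past_index k) (mX k) (nXc k))//.
rewrite RintegralZl//; last exact: iY.
by rewrite EY// mulrC mulNr.
Qed.

End sampling.

(** * The descent step of NT-SGD and its expectation *)

Lemma abs_dot_le {R : realType} {p : nat} (u v : 'rV[R]_p) :
  `|dot u v| <= enorm u * enorm v.
Proof.
rewrite ler_norml cauchy_schwarz andbT lerNl -dotNr.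
by rewrite (le_trans (cauchy_schwarz _ _))// -scaleN1r enormZ normrN1 mul1r.
Qed.

(** The coefficient [3 / 2] adds [1 / 2] from the truncation error and 1 from the quadratic term.
    The inner product on the left involves the untruncated [g], whose mean over batches is known. *)
Lemma descent_step {R : realType} {p : nat} (f : 'rV[R]_p -> R)
    (L G eps eta : R) (w g v : 'rV[R]_p) :
  (forall x, differentiable f x) ->
  (forall x y, enorm (grad f x - grad f y) <= L * enorm (x - y)) ->
  enorm (grad f w) <= G -> enorm g <= G ->
  0 <= L -> 0 < eta -> 0 <= eps <= eta * L / 2 ->
  f (w - eta *: truncate eps g + eta *: v) + eta * dot (grad f w) g
  <= f w + eta * dot (grad f w) v
     + eta ^+ 2 * (L * enorm v ^+ 2 + 3 / 2 * L * G ^+ 2).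
Proof.
move=> df Lf DG gG L0 eta0 /andP[eps0 epsL].
have G0 : 0 <= G := le_trans (enorm_ge0 g) gG.
set D := grad f w in DG *; set h := truncate eps g.
have -> : w - eta *: h + eta *: v = w + eta *: (v - h).
  by rewrite scalerBr -addrA [- _ + _]addrC.
have := descent w (eta *: (v - h)) df Lf.
rewrite dotZr dotBr enormZ gtr0_norm// exprMn -/D.
have hG : enorm h ^+ 2 <= G ^+ 2.
  by rewrite ler_sqr ?nnegrE ?enorm_ge0// (le_trans (enorm_truncate_le eps g)).
have vh := enormB_sqr v h.
have Dgh : dot D g - dot D h <= eta * L / 2 * G ^+ 2.
  rewrite -dotBr; apply: le_trans (cauchy_schwarz _ _) _.
  apply: (@le_trans _ _ (G * (eps * G))).
    apply: ler_pM; rewrite ?enorm_ge0//.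
    apply: le_trans (enormB_truncate_le g eps0) _; exact: ler_wpM2l.
  by rewrite mulrCA -expr2 ler_wpM2r ?sqr_ge0.
have : L / 2 * (eta ^+ 2 * enorm (v - h) ^+ 2) <=
    eta ^+ 2 * (L * (enorm v ^+ 2 + G ^+ 2)).
  rewrite mulrCA ler_wpM2l ?sqr_ge0//.
  by rewrite -mulrA ler_wpM2l//; lra.
have : eta * (dot D g - dot D h) <= eta * (eta * L / 2 * G ^+ 2).
  by rewrite ler_wpM2l// ltW.
lra.
Qed.

Section ntsgd_convergence.
Local Open Scope classical_set_scope.
Context {R : realType} {p n : nat} {Z : Type}.
Variables (loss : 'rV[R]_p -> Z -> R) (S : 'I_n -> Z).
Variables (L G lstar : R) (w0 : 'rV[R]_p).
Hypotheses (p0 : (0 < p)%N) (n0 : (0 < n)%N).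
Hypothesis dloss : forall z w, differentiable (loss ^~ z) w.
Hypothesis lossG : forall w z, enorm (grad (loss ^~ z) w) <= G.
Hypothesis loss_lb : forall w z, lstar <= loss w z.
Hypothesis lossL : forall w w' z,
  enorm (grad (loss ^~ z) w - grad (loss ^~ z) w') <= L * enorm (w - w').
Hypothesis L0 : 0 <= L.
Variables (N : nat) (rho eps eta : R) (m : nat -> nat).
Hypotheses (rho0 : 0 <= rho) (m0 : forall t, (0 < m t)%N).
Hypotheses (eta0 : 0 < eta) (eps_eta : 0 <= eps <= eta * L / 2).
Context {d} {T : measurableType d} (P : probability T R).
Variables (J : T -> nat) (B : forall t, T -> {ffun 'I_(m t) -> 'I_n}).
Variable b : nat -> T -> 'rV[R]_p.
Hypothesis samp : ntsgd_sampling P N (Num.sqrt (rho / p%:R)) J B b.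

Local Notation f := (empirical_loss loss S).

Definition iterate t x :=
  ntsgd loss S w0 (fun=> eta) 2^-1 eps (fun u => B u x) (fun u => b u x) t.

Local Notation w := iterate.

Let df x : differentiable f x. Proof. exact: differentiable_empirical. Qed.

Let fL x y : enorm (grad f x - grad f y) <= L * enorm (x - y).
Proof. exact: empirical_lipschitz. Qed.

Let fG x : enorm (grad f x) <= G.
Proof. exact: enorm_grad_empirical. Qed.

Let G0 : 0 <= G. Proof. exact: le_trans (enorm_ge0 _) (fG 0). Qed.

(** With [beta = 1 / 2] the noise exponent is 1, so noise and truncated gradient share the factor
    [eta]. *)
Lemma iterateS t x : w t.+1 x =
  w t x - eta *: truncate eps (batch_grad loss S (w t x) (B t x)) + eta *: b t x.
Proof.
rewrite /iterate /=; congr (_ + _ *: _).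
have -> : 2^-1 + 2^-1 = 1 :> R by field.
by rewrite powRr1// ltW.
Qed.

Lemma measurable_iterate t i : measurable_fun setT (fun x => w t x 0 i).
Proof.
apply: measurable_ntsgd => // u; first by move=> g _; exact: (batch_measurable samp).
by move=> j _; exact: (noise_measurable samp).
Qed.

Local Notation past_type t :=
  (g_sigma_algebraType (joint_events (source_events J B b) (past t))).

Lemma measurable_iterate_past t i :
  measurable_fun setT ((fun x => w t x 0 i) : past_type t -> R).
Proof. exact: measurable_ntsgd_past. Qed.

Lemma measurable_grad_past t i :
  measurable_fun setT ((fun x => grad f (w t x) 0 i) : past_type t -> R).
Proof.
apply: (measurable_grad (X := w t : past_type t -> _)) => // j.
exact: measurable_iterate_past.
Qed.

Lemma measurable_sqr_grad_past t :
  measurable_fun setT ((fun x => enorm (grad f (w t x)) ^+ 2) : past_type t -> R).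
Proof.
apply: measurable_funX.
apply: (@measurable_enorm _ (past_type t) R p (fun x => grad f (w t x))) => i.
exact: measurable_grad_past.
Qed.

Lemma measurable_dot_past t (g : {ffun 'I_(m t) -> 'I_n}) :
  measurable_fun setT ((fun x => dot (grad f (w t x)) (batch_grad loss S (w t x) g))
    : past_type t -> R).
Proof.
apply: measurable_sum => i; apply: measurable_funM; first exact: measurable_grad_past.
apply: (@measurable_batch_grad _ (past_type t) R p n Z loss S dloss _ g (w t)) => j.
exact: measurable_iterate_past.
Qed.

Lemma past_measurable t (X : T -> R) :
  measurable_fun setT (X : past_type t -> R) -> measurable_fun setT X.
Proof.
move=> mX _ V mV; have := mX measurableT V mV.
apply: sigma_joint_events_measurable; exact: (source_events_measurable samp).
Qed.

Let sqr_grad_le t x : 0 <= enorm (grad f (w t x)) ^+ 2 <= G ^+ 2.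
Proof. by rewrite sqr_ge0 ler_sqr ?nnegrE ?enorm_ge0 ?G0 ?fG. Qed.

Let dot_le t x (g : {ffun 'I_(m t) -> 'I_n}) :
  `|dot (grad f (w t x)) (batch_grad loss S (w t x) g)| <= G ^+ 2.
Proof.
apply: le_trans (abs_dot_le _ _) _; rewrite expr2 ler_pM ?enorm_ge0//.
exact: enorm_batch_grad.
Qed.

Lemma expectation_dot_batch t :
  \int[P]_x dot (grad f (w t x)) (batch_grad loss S (w t x) (B t x)) =
  \int[P]_x (enorm (grad f (w t x)) ^+ 2).
Proof.
pose X (g : {ffun 'I_(m t) -> 'I_n}) x := dot (grad f (w t x)) (batch_grad loss S (w t x) g).
rewrite (expectation_batch samp (X := X) (@measurable_dot_past t)
  (fun g x => @dot_le t x g)).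
set K : R := #|{ffun 'I_(m t) -> 'I_n}|%:R.
have K0 : K != 0.
  by rewrite pnatr_eq0 card_ffun !card_ord expn_eq0 negb_and -lt0n n0.
have iX g : Rintegrable P (X g).
  apply: (Rintegrable_bounded P _ (fun x => @dot_le t x g)).
  exact: past_measurable (@measurable_dot_past t g).
rewrite -Rintegral_sum//.
have -> : \int[P]_x (\sum_g X g x) = \int[P]_x (K * enorm (grad f (w t x)) ^+ 2).
  apply: eq_Rintegral => x _; rewrite enorm_dot -dotZr -sum_batch_grad//.
  rewrite /X /dot exchange_big /=; apply: eq_bigr => i _.
  by rewrite summxE mulr_sumr.
rewrite RintegralZl// ?mulKf//.
apply: (@Rintegrable_bounded _ _ _ P _ (G ^+ 2)).
  exact: past_measurable (@measurable_sqr_grad_past t).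
by move=> x; have /andP[? ?] := sqr_grad_le t x; rewrite ger0_norm.
Qed.

Let sigma0 : 0 <= Num.sqrt (rho / p%:R) :> R. Proof. exact: sqrtr_ge0. Qed.

Let mb t i := noise_measurable samp t i.
Let lb t i := noise_law samp t i.

Lemma Rintegrable_dot_noise t : Rintegrable P (fun x => dot (grad f (w t x)) (b t x)).
Proof.
apply: Rintegrable_sum => i; apply: (@RintegrableMb _ _ _ P _ _ G).
- exact: past_measurable (@measurable_grad_past t i).
- by move=> x; exact: le_trans (norm_le_enorm _ _) (fG _).
- exact: gaussian_integrable sigma0 (mb t i) (lb t i).
Qed.

Lemma expectation_dot_noise t : \int[P]_x dot (grad f (w t x)) (b t x) = 0.
Proof.
rewrite Rintegral_sum => [|i].
  rewrite big1// => i _; apply: (expectation_noise samp) => //.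
    exact: measurable_grad_past.
  by move=> x; exact: le_trans (norm_le_enorm _ _) (fG _).
apply: (@RintegrableMb _ _ _ P _ _ G).
- exact: past_measurable (@measurable_grad_past t i).
- by move=> x; exact: le_trans (norm_le_enorm _ _) (fG _).
- exact: gaussian_integrable sigma0 (mb t i) (lb t i).
Qed.

Lemma Rintegrable_sqr_noise t : Rintegrable P (fun x => enorm (b t x) ^+ 2).
Proof.
under eq_fun do rewrite enorm_sqr.
apply: Rintegrable_sum => i.
exact: gaussian_sqr_integrable sigma0 (mb t i) (lb t i).
Qed.

(** Each of the [p] coordinates has variance parameter [rho / p], so the dimension cancels. *)
Lemma expectation_sqr_noise t : \int[P]_x (enorm (b t x) ^+ 2) <= 6 * rho.
Proof.
under eq_Rintegral do rewrite enorm_sqr.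
rewrite Rintegral_sum => [|i]; last first.
  exact: gaussian_sqr_integrable sigma0 (mb t i) (lb t i).
apply: (@le_trans _ _ (\sum_(i < p) 6 * (rho / p%:R))).
  apply: ler_sum => i _.
  apply: le_trans (gaussian_Rintegral_sqr_le sigma0 (mb t i) (lb t i)) _.
  by rewrite sqr_sqrtr// divr_ge0.
by rewrite sumr_const card_ord -mulrnAr -(mulr_natr (rho / _)) divfK// pnatr_eq0 -lt0n.
Qed.

Let c := L * (6 * rho) + 3 / 2 * L * G ^+ 2.

Lemma measurable_loss_iterate t : measurable_fun setT (fun x => f (w t x)).
Proof.
apply: (measurable_continuous_rV (X := w t)) => [x|i].
  exact: differentiable_continuous.
exact: measurable_iterate.
Qed.

Let f_lb x : lstar <= f x. Proof. exact: empirical_ge. Qed.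

Lemma step_bound t x :
  f (w t.+1 x) + eta * dot (grad f (w t x)) (batch_grad loss S (w t x) (B t x))
  <= f (w t x) + eta * dot (grad f (w t x)) (b t x)
     + eta ^+ 2 * (L * enorm (b t x) ^+ 2 + 3 / 2 * L * G ^+ 2).
Proof. by rewrite iterateS; apply: descent_step => //; exact: enorm_batch_grad. Qed.

Let Rintegrable_step_rhs t : Rintegrable P (fun x => f (w t x)) ->
  Rintegrable P (fun x => f (w t x) + eta * dot (grad f (w t x)) (b t x)
     + eta ^+ 2 * (L * enorm (b t x) ^+ 2 + 3 / 2 * L * G ^+ 2)).
Proof.
move=> IH; apply: RintegrableD; last apply: RintegrableZ.
  by apply: RintegrableD => //; apply: RintegrableZ; exact: Rintegrable_dot_noise.
apply: RintegrableD; last exact: Rintegrable_cst.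
by apply: RintegrableZ; exact: Rintegrable_sqr_noise.
Qed.

(** The loss may be unbounded above, so integrability is carried along the run: each new value lies
    between [lstar] and the integrable bound of [step_bound]. *)
Lemma Rintegrable_loss_iterate t : Rintegrable P (fun x => f (w t x)).
Proof.
elim: t => [|t IH]; first exact: (Rintegrable_cst P (f w0)).
(* The last term pays for moving the inner product with the batch gradient, at least [- G ^+ 2], to
   the right. *)
pose U x := f (w t x) + eta * dot (grad f (w t x)) (b t x)
  + eta ^+ 2 * (L * enorm (b t x) ^+ 2 + 3 / 2 * L * G ^+ 2) + eta * G ^+ 2.
have iU : Rintegrable P U.
  exact: (RintegrableD (Rintegrable_step_rhs IH) (Rintegrable_cst P _)).
have iUn : Rintegrable P (fun x => `|U x| + `|lstar|).
  apply: (RintegrableD _ (Rintegrable_cst P _)).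
  apply: (Rintegrable_le _ iU) => [|x]; last by rewrite normr_id.
  by apply: measurableT_comp => //; exact: Rintegrable_measurable iU.
apply: (Rintegrable_le _ iUn); first exact: measurable_loss_iterate.
move=> x; rewrite [leRHS]ger0_norm ?addr_ge0//.
have /ler_normlP[dG _] := @dot_le t x (B t x).
have : - (eta * dot (grad f (w t x)) (batch_grad loss S (w t x) (B t x)))
    <= eta * G ^+ 2 by rewrite -mulrN ler_wpM2l// ltW.
have := step_bound t x; have := f_lb (w t.+1 x).
have := ler_norm (U x); have := ler_norm (- lstar); rewrite normrN.
have := normr_ge0 (U x); have := normr_ge0 lstar.
by have := erefl (U x); rewrite {2}/U => *; rewrite ler_norml; apply/andP; split; lra.
Qed.

Lemma expected_step t :
  \int[P]_x f (w t.+1 x) + eta * \int[P]_x (enorm (grad f (w t x)) ^+ 2)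
  <= \int[P]_x f (w t x) + eta ^+ 2 * c.
Proof.
have iX : Rintegrable P (fun x =>
    dot (grad f (w t x)) (batch_grad loss S (w t x) (B t x))).
  apply: (@Rintegrable_bounded _ _ _ P _ (G ^+ 2)); last by move=> x; exact: dot_le.
  pose h (g : {ffun 'I_(m t) -> 'I_n}) x := dot (grad f (w t x)) (batch_grad loss S (w t x) g).
  apply: (measurable_select (h := h)) => g; first exact: (batch_measurable samp).
  exact: past_measurable (@measurable_dot_past t g).
have iD := Rintegrable_dot_noise t.
have iB := Rintegrable_sqr_noise t.
have iF := Rintegrable_loss_iterate.
rewrite -expectation_dot_batch -RintegralZl// -RintegralD//; last 2 first.
- exact: iF.
- exact: RintegrableZ.
apply: (@le_trans _ _ (\int[P]_x (f (w t x) + eta * dot (grad f (w t x)) (b t x)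
     + eta ^+ 2 * (L * enorm (b t x) ^+ 2 + 3 / 2 * L * G ^+ 2)))).
  apply: le_Rintegral => //.
  - by apply: RintegrableD => //; exact: RintegrableZ.
  - exact: Rintegrable_step_rhs.
  - by move=> x _; exact: step_bound.
have iC : Rintegrable P (fun x => L * enorm (b t x) ^+ 2 + 3 / 2 * L * G ^+ 2).
  by apply: RintegrableD; [exact: RintegrableZ|exact: Rintegrable_cst].
rewrite RintegralD//; last 2 first.
- by apply: RintegrableD => //; exact: RintegrableZ.
- exact: RintegrableZ.
rewrite RintegralD//; [|exact: iF|exact: RintegrableZ].
rewrite [X in _ + X + _](_ : _ = 0) ?addr0; last first.
  by rewrite RintegralZl// expectation_dot_noise mulr0.
rewrite lerD2l [leLHS]RintegralZl// ler_wpM2l ?sqr_ge0//.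
rewrite RintegralD//; [|exact: RintegrableZ|exact: Rintegrable_cst].
rewrite RintegralZl// Rintegral_cst1 lerD2r ler_wpM2l//.
exact: expectation_sqr_noise.
Qed.

Lemma sum_sqr_grad k :
  eta * \sum_(0 <= t < k) \int[P]_x (enorm (grad f (w t x)) ^+ 2)
  <= f w0 - lstar + k%:R * (eta ^+ 2 * c).
Proof.
have lb_f t : lstar <= \int[P]_x f (w t x).
  rewrite -[leLHS](Rintegral_cst1 P); apply: le_Rintegral => //.
  - exact: Rintegrable_cst.
  - exact: Rintegrable_loss_iterate.
(* The expected loss stays on the left so that the induction telescopes; [lstar] replaces it only at
   the end. *)
suff : \int[P]_x f (w k x)
    + eta * \sum_(0 <= t < k) \int[P]_x (enorm (grad f (w t x)) ^+ 2)
    <= f w0 + k%:R * (eta ^+ 2 * c) by have := lb_f k; lra.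
elim: k => [|k IH].
  have -> : \int[P]_x f (w 0 x) = f w0 := Rintegral_cst1 P (f w0).
  by rewrite big_geq// mulr0 mul0r !addr0.
rewrite big_nat_recr//= -natr1.
by have := expected_step k; lra.
Qed.

Lemma expected_sqr_grad : (0 < N)%N -> eta = (Num.sqrt N%:R)^-1 ->
  ('E_P[fun x => (enorm (grad f (w (J x) x)) ^+ 2)%R]
   <= ((f w0 - lstar + 2 * c) / Num.sqrt N%:R)%:E)%E.
Proof.
move=> N0 etaE.
pose X k x := enorm (grad f (w k x)) ^+ 2.
have mX : measurable_fun setT (fun x => X (J x) x).
  apply: (measurable_select (h := X)) => k; first exact: (index_measurable samp).
  exact: past_measurable (@measurable_sqr_grad_past k).
have iX : Rintegrable P (fun x => X (J x) x).
  apply: (@Rintegrable_bounded _ _ _ P _ (G ^+ 2) mX) => x.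
  by have /andP[? ?] := sqr_grad_le (J x) x; rewrite ger0_norm.
rewrite unlock -[leLHS]fineK; last exact: integrable_fin_num iX.
rewrite lee_fin.
apply: le_trans (expectation_index samp N0 measurable_sqr_grad_past sqr_grad_le mX) _.
have eN : eta ^+ 2 = N%:R^-1 by rewrite etaE exprVn sqr_sqrtr.
have N1 : (1 : R) <= N%:R by rewrite ler1n.
have Ngt0 : (0 : R) < N%:R by rewrite ltr0n.
have c0 : 0 <= c by rewrite /c; have := mulr_ge0 L0 rho0; have := mulr_ge0 L0 (sqr_ge0 G); lra.
(* The output is drawn from iterates [1..N], while telescoping starts at 0: [N + 1] terms are summed
   and the nonnegative term 0 is dropped. Then [(N + 1) / N <= 2] explains the factor in [2 * c]. *)
have := sum_sqr_grad N.+1; rewrite big_ltn// mulrDr.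
have : 0 <= eta * \int[P]_x (enorm (grad f (w 0 x)) ^+ 2).
  apply: mulr_ge0; first exact: ltW.
  by apply: Rintegral_ge0 => x _; rewrite sqr_ge0.
set s := \sum_(_ <= _ < _) _.
have : N.+1%:R * (eta ^+ 2 * c) <= 2 * c.
  rewrite eN mulrA ler_wpM2r// ler_pdivrMr// -natr1; lra.
move=> H1 H2 H3; have {H1 H2 H3} H : eta * s <= f w0 - lstar + 2 * c by lra.
(* [1 / N] is [eta ^+ 2]: one factor is used by the bound on [eta * s], the other is the rate. *)
rewrite -etaE -eN expr2 -mulrA [leRHS]mulrC ler_wpM2l//; exact: ltW.
Qed.

End ntsgd_convergence.

(** Choosing [C] before every other quantity expresses the [O]: it can depend on [L], [G] and the
    initial gap only. *)
Theorem theorem4 (R : realType) (L G gap : R) :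
  exists2 C : R, 0 <= C &
  forall (p n : nat) (Z : Type) (loss : 'rV[R]_p -> Z -> R) (S : 'I_n -> Z)
    (lstar : R) (w0 : 'rV[R]_p),
  (0 < p)%N -> (0 < n)%N ->
  (forall (z : Z) (w : 'rV[R]_p), differentiable (loss ^~ z) w) ->
  (forall (w : 'rV[R]_p) (z : Z), enorm (grad (loss ^~ z) w) <= G) ->
  (forall (w : 'rV[R]_p) (z : Z), lstar <= loss w z) ->
  (forall (w w' : 'rV[R]_p) (z : Z),
     enorm (grad (loss ^~ z) w - grad (loss ^~ z) w') <= L * enorm (w - w')) ->
  empirical_loss loss S w0 - lstar = gap ->
  forall (N : nat) (rho eps : R) (m : nat -> nat),
  (0 < N)%N -> 0 <= rho -> (forall t, (0 < m t)%N) ->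
  let eta : R := (Num.sqrt N%:R)^-1 in
  0 <= eps <= Num.min 1 (eta * L / 2) ->
  forall (d : measure_display) (T : measurableType d) (P : probability T R)
    (J : T -> nat) (B : forall t, T -> {ffun 'I_(m t) -> 'I_n})
    (b : nat -> T -> 'rV[R]_p),
  let w (t : nat) (x : T) : 'rV[R]_p :=
    ntsgd loss S w0 (fun=> eta) 2^-1 eps (fun u => B u x) (fun u => b u x) t in
  ntsgd_sampling P N (Num.sqrt (rho / p%:R)) J B b ->
  ('E_P[fun x : T => (enorm (grad (empirical_loss loss S) (w (J x) x)) ^+ 2)%R]
    <= (C * (L * (G ^+ 2 + rho ^+ 2) / Num.sqrt N%:R))%:E)%E.
Proof.
(* The summands absorb, in turn, [gap], the part [12 L] of [12 L rho <= 12 L (1 + rho^2)], and the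
   remaining [12 L rho^2 + 3 L G^2]. The divisions are meaningful only for nonzero [L] and [G],
   hence the separate case below; the absolute value keeps [C] nonnegative for any real [gap]. *)
exists (`|gap / (L * G ^+ 2)| + 12 / G ^+ 2 + 15).
  by rewrite !addr_ge0// divr_ge0 ?sqr_ge0.
move=> p n Z loss S lstar w0 p0 n0 dloss lossG loss_lb lossL gapE N rho eps m.
move=> N0 rho0 m0 eta /andP[eps0 eps_min] d T P J B b w samp.
have eps_eta : 0 <= eps <= eta * L / 2.
  by rewrite eps0 (le_trans eps_min)// ge_min lexx orbT.
have sN0 : 0 < Num.sqrt N%:R :> R by rewrite sqrtr_gt0 ltr0n.
have eta0 : 0 < eta by rewrite invr_gt0.
pose z0 := S (Ordinal n0).
have L0 : 0 <= L.
  (* A point other than 0, which exists because [p] is positive: the Lipschitz bound between [u] and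
     0 then fixes the sign of [L]. *)
  pose u : 'rV[R]_p := const_mx 1.
  have u1 : 1 <= enorm u.
    by have := norm_le_enorm u (Ordinal p0); rewrite mxE normr1.
  have := le_trans (enorm_ge0 _) (lossL u 0 z0).
  by rewrite subr0 pmulr_lge0// (lt_le_trans ltr01).
have G0 : 0 <= G := le_trans (enorm_ge0 _) (lossG 0 z0).
have rhs0 (C : R) : 0 <= C -> 0 <= C * (L * (G ^+ 2 + rho ^+ 2) / Num.sqrt N%:R).
  by move=> C0; rewrite mulr_ge0// divr_ge0 ?sqrtr_ge0// mulr_ge0// addr_ge0 ?sqr_ge0.
have [LG|] := boolP ((L == 0) || (G == 0)).
  have grad0 v : grad (empirical_loss loss S) v = 0.
    case/orP: LG => /eqP zero.
      apply: (@grad_flat _ _ _ lstar) => x.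
      - exact: differentiable_empirical.
      - by rewrite -zero; exact: empirical_lipschitz.
      - exact: empirical_ge.
    apply: enorm_eq0; apply/eqP; rewrite eq_le enorm_ge0 andbT -[leRHS]zero.
    exact: enorm_grad_empirical.
  rewrite [X in expectation _ X](_ : _ = cst 0); last first.
    by apply/funext => x; rewrite grad0 enorm0 expr0n.
  by rewrite expectation_cst lee_fin rhs0// !addr_ge0// divr_ge0 ?sqr_ge0.
rewrite negb_or => /andP[Ln0 Gn0].
have Lp : 0 < L by rewrite lt_def Ln0.
have Gp : 0 < G ^+ 2 by rewrite exprn_even_gt0.
apply: le_trans (expected_sqr_grad S w0 p0 n0 dloss lossG loss_lb lossL L0 rho0 m0
  eta0 eps_eta samp N0 erefl) _.
rewrite lee_fin gapE [leRHS]mulrA ler_pM2r ?invr_gt0//.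
have gap_le : gap <= `|gap / (L * G ^+ 2)| * (L * (G ^+ 2 + rho ^+ 2)).
  have LG0 : 0 < L * G ^+ 2 by rewrite mulr_gt0.
  rewrite -[leLHS](divfK (lt0r_neq0 LG0)).
  apply: le_trans (ler_wpM2r (ltW LG0) (ler_norm _)) _.
  by rewrite ler_wpM2l// ler_wpM2l// lerDl sqr_ge0.
have LG12 : 12 * L <= 12 / G ^+ 2 * (L * (G ^+ 2 + rho ^+ 2)).
  rewrite mulrAC ler_pdivlMr//.
  have := mulr_ge0 L0 (sqr_ge0 rho); nra.
have : L * rho <= L * (1 + rho ^+ 2) by rewrite ler_wpM2l//; nra.
have := mulr_ge0 L0 (sqr_ge0 rho); have := mulr_ge0 L0 (sqr_ge0 G).
rewrite !mulrDl; lra.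
Qed.
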